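(* Let $m\ge1$, let $f=\sum_{|\alpha|\ge1}a_\alpha X_\alpha$ be a positive regular free holomorphic function and let $\mathcal P$ be a family of noncommutative polynomials. If $A=(A_1,\dots,A_n)\in B(\mathcal H)^n$ is such that $\sum_{|\alpha|\ge1}a_\alpha A_\alpha A_\alpha^*$ is convergent in the weak operator topology and $p(A_1,\dots,A_n)=0$ for all $p\in\mathcal P$, then the following statements are equivalent. (i) There exist $T=(T_1,\dots,T_n)\in\mathcal V^m_{f,\mathcal P}(\mathcal H)$ such that $(id-\Phi_{f,T})^m(I)=0$ and an invertible operator $Y\in B(\mathcal H)$ such that $$A_i=Y^{-1}T_iY,\qquad i=1,\dots,n.$$ (ii) There exist positive constants $0<c\le d$ such that $$cI\le\Phi_{f,A}^k(I)\le dI,\qquad k\in\mathbb N.$$ (iii) $\Phi_{f,A}$ is power bounded and there exists an invertible positive operator $Q\in B(\mathcal H)$ such that $(id-\Phi_{f,A})^m(Q)=0$.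
   Context: Let $n\in\mathbb N=\{1,2,\dots\}$. $\mathbb F_n^+$ is the unital free semigroup on generators $g_1,\dots,g_n$ with identity $g_0$; $|\alpha|$ is the word length ($|g_0|=0$). For $X=(X_1,\dots,X_n)\in B(\mathcal H)^n$ ($\mathcal H$ a complex Hilbert space) put $X_\alpha=X_{i_1}\cdots X_{i_k}$ if $\alpha=g_{i_1}\cdots g_{i_k}$ and $X_{g_0}=I$. A positive regular free holomorphic function is a formal series $f=\sum_{\alpha\in\mathbb F_n^+}a_\alpha X_\alpha$ in noncommuting variables with $\limsup_{k\to\infty}(\sum_{|\alpha|=k}|a_\alpha|^2)^{1/2k}<\infty$, $a_\alpha\ge 0$ for all $\alpha$, $a_{g_0}=0$, and $a_{g_i}>0$ for $i=1,\dots,n$. Whenever $\sum_{|\alpha|\ge1}a_\alpha X_\alpha X_\alpha^*$ converges in the weak operator topology (WOT), $\Phi_{f,X}(Y)=\sum_{|\alpha|\ge1}a_\alpha X_\alpha YX_\alpha^*$ for $Y\in B(\mathcal H)$ (WOT convergence). $id$ is the identity map on $B(\mathcal H)$. A linear map $\varphi$ on $B(\mathcal H)$ is power bounded if there is $M>0$ with $\|\varphi^k\|\le M$ for all $k\in\mathbb N$. $\mathbf D_f^m(\mathcal H)$ is the set of $X\in B(\mathcal H)^n$ (with the series above WOT convergent) such that $(id-\Phi_{f,X})^s(I)\ge 0$ for $s=1,\dots,m$, and $\mathcal V^m_{f,\mathcal P}(\mathcal H)=\{X\in\mathbf D_f^m(\mathcal H): p(X_1,\dots,X_n)=0\ \forall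 p\in\mathcal P\}$. *)

(* Defs.v *)
From HB Require Import structures.
From mathcomp Require Import all_boot all_order all_algebra finmap.
From mathcomp Require Import complex sesquilinear.
From mathcomp Require Import all_classical all_reals all_analysis.
From mathcomp Require Import summability.
From mathcomp.multinomials Require monalg.

Set Implicit Arguments.
Unset Strict Implicit.
Unset Printing Implicit Defensive.

Import Order.TTheory GRing.Theory Num.Theory.
Import numFieldNormedType.Exports.
(* The notations of monalg clash with those of all_analysis. *)
Import (canonicals, coercions) monalg.

Local Open Scope classical_set_scope.
Local Open Scope ring_scope.

(* The inner product is linear in its first argument and conjugate-linear in
   the second one; the norm of a vector is R[i]-valued, as for any
   normedModType R[i]. *)
HB.mixin Record CompleteNormedModule_isHilbert (R : realType) H
    of CompleteNormedModule R[i] H := {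
  inner : {dot H for @Num.conj R[i]};
  sqr_normE : forall x : H, `|x| ^+ 2 = inner x x
}.

#[short(type="hilbertType")]
HB.structure Definition Hilbert (R : realType) :=
  {H of CompleteNormedModule R[i] H & CompleteNormedModule_isHilbert R H}.

Notation "''[' x , y ]" := (inner x y) (format "''[' x ,  y ]") : ring_scope.

Section BoundedOperators.
Context {R : realType} {H : hilbertType R}.

Definition bounded_operator : {pred H -> H} := fun f => `[<
  linear f /\ exists2 M : R[i], 0 <= M & forall x, `|f x| <= M * `|x| >].

Record bop : Type := Bop { bop_fun :> H -> H; _ : bop_fun \in bounded_operator }.

HB.instance Definition _ := [isSub for bop_fun].
HB.instance Definition _ := gen_eqMixin bop.
HB.instance Definition _ := gen_choiceMixin bop.
Fact bounded_operatorP f : reflect (linear f /\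
  exists2 M : R[i], 0 <= M & forall x, `|f x| <= M * `|x|) (f \in bounded_operator).
Proof. exact: asboolP. Qed.

Fact bounded_operator_submod : submod_closed bounded_operator.
Proof.
split=> [|c f g /bounded_operatorP[lf [M M0 Mf]] /bounded_operatorP[lg [N N0 Ng]]].
  apply/bounded_operatorP; split; first by move=> c x y; rewrite /= scaler0 addr0.
  by exists 0 => // x; rewrite normr0 mul0r.
apply/bounded_operatorP; split.
  move=> b x y; rewrite !fctE lf lg !scalerDr !scalerA mulrC.
  by rewrite addrACA.
exists (`|c| * M + N); first by rewrite addr_ge0// mulr_ge0.
move=> x; rewrite !fctE mulrDl (le_trans (ler_normD _ _))// lerD//.
by rewrite normrZ -mulrA ler_wpM2l.
Qed.

HB.instance Definition _ :=
  GRing.isSubmodClosed.Build R[i] (H -> H) bounded_operator bounded_operator_submod.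
HB.instance Definition _ := [SubChoice_isSubLmodule of bop by <:].

Fact bop_linear (T : bop) : linear T.
Proof. by case/bounded_operatorP: (valP T). Qed.

Fact bop1_subproof : (id : H -> H) \in bounded_operator.
Proof.
by apply/bounded_operatorP; split=> //; exists 1 => // x; rewrite mul1r.
Qed.

Fact bopM_subproof (S T : bop) : (S \o T : H -> H) \in bounded_operator.
Proof.
case/bounded_operatorP: (valP S) => /= lf [M M0 Mf].
case/bounded_operatorP: (valP T) => /= lg [N N0 Ng].
apply/bounded_operatorP; split.
  by move=> c x y; rewrite /= lg lf.
exists (M * N); first exact: mulr_ge0.
by move=> x; rewrite /= (le_trans (Mf _))// -mulrA ler_wpM2l.
Qed.

Definition bop1 : bop := Bop bop1_subproof.
Definition bopM (S T : bop) : bop := Bop (bopM_subproof S T).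

Fact bopMA : associative bopM.
Proof. by move=> S T U; apply/val_inj. Qed.

Fact bop1M : left_id bop1 bopM.
Proof. by move=> S; apply/val_inj. Qed.

Fact bopM1 : right_id bop1 bopM.
Proof. by move=> S; apply/val_inj. Qed.

Fact bopMDl : left_distributive bopM +%R.
Proof. by move=> S T U; apply/val_inj. Qed.

Fact bopMDr : right_distributive bopM +%R.
Proof.
move=> S T U; apply/val_inj/funext => x /=.
by have := bop_linear S 1 (T x) (U x); rewrite !scale1r.
Qed.

(* Only a pzRingType, since the zero Hilbert space is allowed. *)
HB.instance Definition _ :=
  GRing.Zmodule_isPzRing.Build bop bopMA bop1M bopM1 bopMDl bopMDr.

(* The Riesz representation theorem provides such an S, and it is unique. *)
Definition adj (T : bop) : bop :=
  xget 0 [set S : bop | forall x y, '[T x, y] = '[x, S y]].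

Definition posop (T : bop) : Prop := forall x, 0 <= '[T x, x].

Definition leop (S T : bop) : Prop := posop (T - S).

Definition invertible (T : bop) : Prop :=
  exists S : bop, T * S = 1 /\ S * T = 1.

Definition wot_cvg (I : Type) (F : set_system I) (u : I -> bop) (T : bop) : Prop :=
  forall x y : H, '[u i x, y] @[i --> F] --> '[T x, y].

Definition opnorm (T : bop) : \bar R :=
  ereal_sup [set (complex.Re `|T x|)%:E | x in [set x | `|x| <= 1]].

Definition map_norm (phi : bop -> bop) : \bar R :=
  ereal_sup [set opnorm (phi T) | T in [set T | (opnorm T <= 1)%E]].

Definition power_bounded (phi : bop -> bop) : Prop :=
  exists2 M : R, 0 < M &
    forall k, (0 < k)%N -> (map_norm (iter k phi) <= M%:E)%E.

Definition id_minus (phi : bop -> bop) : bop -> bop := fun T => T - phi T.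

End BoundedOperators.
Arguments bop {R} H.

(* A word g_(i_1)...g_(i_k) is the sequence [:: i_1; ...; i_k]; the identity
   g_0 is the empty sequence. *)
Section Domains.
Context {R : realType} {n : nat} {H : hilbertType R}.
Implicit Types (a : seq 'I_n -> R) (X : 'I_n -> bop H).

Definition positive_regular a : Prop :=
  [/\ (limn_esup (fun k => ((\sum_(w : k.-tuple 'I_n) `|a w| ^+ 2)
                              `^ (2 * k)%:R^-1)%:E) < +oo)%E,
      forall w, 0 <= a w,
      a [::] = 0 &
      forall i, 0 < a [:: i]].

Definition word_eval X (w : seq 'I_n) : bop H := \prod_(i <- w) X i.

Definition Phi_term a X (Y : bop H) (w : seq 'I_n) : bop H :=
  if (0 < size w)%N
  then (a w)%:C%C *: (word_eval X w * Y * adj (word_eval X w)) else 0.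

(* Unordered sum over the words: limit along the net of finite partial sums. *)
Definition Phi_sum a X (Y Z : bop H) : Prop :=
  wot_cvg totally (partial_sum (Phi_term a X Y)) Z.

Definition Phi_summable a X : Prop := exists Z, Phi_sum a X 1 Z.

(* Under [Phi_summable a X] with a >= 0 the sum exists for every Y, and it is
   unique. *)
Definition Phi a X (Y : bop H) : bop H := xget 0 [set Z | Phi_sum a X Y Z].

Definition domain_D a (m : nat) : set ('I_n -> bop H) :=
  [set X | Phi_summable a X /\
    forall s, (1 <= s <= m)%N -> posop (iter s (id_minus (Phi a X)) 1)].

(* Noncommutative polynomials: the monoid algebra of the free monoid. *)
Definition ncpoly := monalg.malg (monalg.fmonom 'I_n) R[i].

Definition ncpoly_eval X (p : ncpoly) : bop H :=
  \sum_(w <- monalg.msupp p) monalg.mcoeff w p *: word_eval X w.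

Definition variety_V a (m : nat) (P : set ncpoly) : set ('I_n -> bop H) :=
  [set X | domain_D a m X /\ forall p, P p -> ncpoly_eval X p = 0].

End Domains.
Arguments ncpoly R n : clear implicits.

(* Main.v *)
Require Import Defs.
From mathcomp Require Import all_boot all_order all_algebra complex.
From mathcomp Require Import finmap sesquilinear.
From mathcomp Require Import all_classical all_reals all_analysis.
From mathcomp Require Import summability.
From mathcomp Require Import ring lra.

(** Write Phi for Phi_(f,A), a positive linear map. Two facts carry the proof.

    Power boundedness leaves no Jordan block at the eigenvalue 1
    ([fixed_coboundary_eq0]): if F = E - Phi E is fixed by Phi, then
    telescoping gives E - Phi^k E = k F for every k; the left side stays
    bounded, so F = 0. Hence (id - Phi)^m Q = 0 already forces Phi Q = Q
    ([iter_id_minus_eq0]). For a positive map, power boundedness follows from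
    a bound on Phi^k(I), because every operator is a combination of four
    positive ones ([posop_decomposition], [pos_power_bounded]).

    The map Phi is normal ([Phi_normal]): it commutes with weak limits of
    bounded families of positive operators, because for 0 <= Y <= d I the tail
    of the series of Phi(Y) is dominated by d times the tail of the series of
    Phi(I), which does not depend on Y.

    From (i) to (ii): Phi_T(I) <= I makes the sequence Phi_T^k(I) bounded, so
    Phi_T(I) = I by the first fact. Similarity turns the powers of Phi_T into
    those of Phi ([iter_Phi_sim]), and Phi^k(I) is the conjugate by Y^-1 of
    Phi_T^k(Y Y^* ), which lies between two positive multiples of Phi_T^k(I) =
    I.

    From (ii) to (iii): the Cesaro means of Phi^k(I) lie between c I and d I.
    Their weak limit Q along a free ultrafilter on the integers is again
    between these bounds, and normality gives Phi(Q) = Q, since Phi moves the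
    N-th mean by O(1/N) ([fixed_point_between]). Being bounded below, Q is
    invertible.

    From (iii) to (i): by the first fact Phi(Q) = Q. Write Q = U U^* with U
    invertible, for instance the positive square root of Q
    ([pos_invertible_factor]); then T_i = U^-1 A_i U satisfies Phi_T(I) = I.

    Throughout, the Hilbert space is handled through the real inner product Re
    <x, y>, which determines the complex one. Weak convergence, positivity and
    order of operators then become statements about real numbers. *)

Set Implicit Arguments.
Unset Strict Implicit.
Unset Printing Implicit Defensive.

Import Order.TTheory GRing.Theory Num.Theory.
Import numFieldNormedType.Exports.

Local Open Scope classical_set_scope.
Local Open Scope ring_scope.

(** * The real inner product *)

Section RealForm.
Context {R : realType} {H : hilbertType R}.
Implicit Types (x y z : H) (c : R[i]) (r s : R).

Definition rdot x y : R := complex.Re '[x, y].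

(** The norm of a vector is a complex number without imaginary part; this is
    the same number seen in R. *)
Definition rnorm x : R := complex.Re `|x|.

Lemma innerC x y : '[x, y] = Num.conj '[y, x].
Proof. by rewrite hermC expr0 mul1r. Qed.

Lemma innerZr c x y : '[x, c *: y] = Num.conj c * '[x, y].
Proof. by rewrite linearZr_LR. Qed.

Lemma innerZl c x y : '[c *: x, y] = c * '[x, y].
Proof. by rewrite linearZl_LR. Qed.

Lemma conjcE c : Num.conj c = conjc c.
Proof. by []. Qed.

Lemma rdotC x y : rdot x y = rdot y x.
Proof. by rewrite /rdot innerC conjcE; case: '[y, x]. Qed.

Lemma ReD (a b : R[i]) : complex.Re (a + b) = complex.Re a + complex.Re b.
Proof. by case: a; case: b. Qed.

Lemma ReN (a : R[i]) : complex.Re (- a) = - complex.Re a.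
Proof. by case: a. Qed.

Lemma rdotDl x y z : rdot (x + y) z = rdot x z + rdot y z.
Proof. by rewrite /rdot linearDl ReD. Qed.

Lemma rdotZl c x y : rdot (c *: x) y = rdot x (conjc c *: y).
Proof. by rewrite /rdot innerZl innerZr conjcE conjcK. Qed.

Lemma Re_rM r c : complex.Re (r%:C%C * c) = r * complex.Re c.
Proof. by case: c => a b /=; rewrite mul0r subr0. Qed.

Lemma rdotrZl r x y : rdot (r%:C%C *: x) y = r * rdot x y.
Proof. by rewrite /rdot innerZl Re_rM. Qed.

Lemma rdotDr x y z : rdot z (x + y) = rdot z x + rdot z y.
Proof. by rewrite rdotC rdotDl !(rdotC z). Qed.

Lemma rdotrZr r x y : rdot x (r%:C%C *: y) = r * rdot x y.
Proof. by rewrite rdotC rdotrZl (rdotC x). Qed.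

Lemma rdotNl x y : rdot (- x) y = - rdot x y.
Proof. by rewrite /rdot linearNl ReN. Qed.

Lemma rdotNr x y : rdot x (- y) = - rdot x y.
Proof. by rewrite rdotC rdotNl rdotC. Qed.

Lemma rdotBl x y z : rdot (x - y) z = rdot x z - rdot y z.
Proof. by rewrite rdotDl rdotNl. Qed.

Lemma rdotBr x y z : rdot z (x - y) = rdot z x - rdot z y.
Proof. by rewrite rdotDr rdotNr. Qed.

Lemma rdot0l x : rdot 0 x = 0.
Proof. by rewrite -(subrr x) rdotBl subrr. Qed.

Lemma rdot0r x : rdot x 0 = 0.
Proof. by rewrite rdotC rdot0l. Qed.

(** The real inner product contains the complex one: the second argument
    absorbs the multiplication by i. *)
Lemma inner_rdot x y :
  '[x, y] = (rdot x y +i* rdot x ('i%C *: y))%C.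
Proof.
rewrite /rdot innerZr conjcE; case: '[x, y] => a b /=.
by congr (_ +i* _)%C; ring.
Qed.

Lemma inner_rdotP x y z w :
  (forall c, rdot x (c *: y) = rdot z (c *: w)) -> '[x, y] = '[z, w].
Proof.
by move=> e; rewrite !inner_rdot e; have := e 1; rewrite !scale1r => ->.
Qed.

Lemma rnormE x : `|x| = (rnorm x)%:C%C.
Proof. by rewrite RRe_real // ger0_real. Qed.

Lemma rnorm_ge0 x : 0 <= rnorm x.
Proof. by rewrite -ler0c -rnormE. Qed.

Lemma rnorm_sqr x : rnorm x ^+ 2 = rdot x x.
Proof. by rewrite /rdot -sqr_normE rnormE -rmorphXn. Qed.

Lemma rdot_ge0 x : 0 <= rdot x x.
Proof. by rewrite -rnorm_sqr sqr_ge0. Qed.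

Lemma rnorm_eq0 x : rnorm x = 0 -> x = 0.
Proof. by move=> e; apply/normr0_eq0; rewrite rnormE e. Qed.

Lemma rdot_eq0 x : rdot x x = 0 -> x = 0.
Proof.
by rewrite -rnorm_sqr => /eqP; rewrite sqrf_eq0 => /eqP /rnorm_eq0.
Qed.

Lemma rdot_eq x y : (forall z, rdot x z = rdot y z) -> x = y.
Proof.
move=> e; apply/eqP; rewrite -subr_eq0; apply/eqP/rdot_eq0.
by rewrite rdotBl e subrr.
Qed.

Lemma rnormD x y : rnorm (x + y) <= rnorm x + rnorm y.
Proof. by rewrite -lecR rmorphD /= -!rnormE ler_normD. Qed.

Lemma rnormN x : rnorm (- x) = rnorm x.
Proof. by rewrite /rnorm normrN. Qed.

Lemma rnormB x y : rnorm (x - y) = rnorm (y - x).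
Proof. by rewrite -rnormN opprB. Qed.

Lemma rnormZ c x : rnorm (c *: x) = complex.Re `|c| * rnorm x.
Proof. by rewrite /rnorm normrZ normc_def Re_rM. Qed.

Lemma rnormrZ r x : rnorm (r%:C%C *: x) = `|r| * rnorm x.
Proof. by rewrite rnormZ normc_def /= expr0n addr0 sqrtr_sqr. Qed.

Lemma rnormi x : rnorm ('i%C *: x) = rnorm x.
Proof. by rewrite rnormZ normc_def /= expr0n add0r expr1n sqrtr1 mul1r. Qed.

(** Cauchy-Schwarz for a semidefinite real form, where F x x may vanish:
    expand F at F x y * x - F x x * y; when F x x = 0 the form is affine in
    the coefficient of x, which forces F x y = 0. *)
Lemma form_CauchySchwarz (F : H -> H -> R) x y :
  (forall u v w, F (u + v) w = F u w + F v w) ->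
  (forall r u v, F (r%:C%C *: u) v = r * F u v) ->
  (forall u v, F u v = F v u) -> (forall u, 0 <= F u u) ->
  F x y ^+ 2 <= F x x * F y y.
Proof.
move=> FD FZ FC F0.
have key s t : 0 <= s ^+ 2 * F x x + 2 * s * t * F x y + t ^+ 2 * F y y.
  have := F0 (s%:C%C *: x + t%:C%C *: y).
  rewrite FD !FZ !(FC _ (_ + _)) !FD !FZ (FC y x).
  by congr (_ <= _); ring.
have := key (F x y) (- F x x).
have -> : F x y ^+ 2 * F x x + 2 * F x y * - F x x * F x y
    + (- F x x) ^+ 2 * F y y = F x x * (F x x * F y y - F x y ^+ 2) by ring.
have := F0 x; rewrite le_eqVlt => /predU1P[x0 _|x0]; last first.
  by rewrite pmulr_rge0 // subr_ge0.
have kk t : 0 <= 2 * t * F x y + F y y.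
  by have := key t 1; rewrite -x0 mulr0 add0r mulr1 expr1n mul1r.
rewrite -x0 mul0r.
have [->|n0] := eqVneq (F x y) 0; first by rewrite expr0n.
have := kk (- (F y y + 1) / (2 * F x y)).
have -> : 2 * (- (F y y + 1) / (2 * F x y)) * F x y = - (F y y + 1) by field.
by lra.
Qed.

Lemma rdot_CauchySchwarz x y : `|rdot x y| <= rnorm x * rnorm y.
Proof.
rewrite -(@ler_pXn2r _ 2) ?nnegrE ?mulr_ge0 ?rnorm_ge0 //.
rewrite exprMn !rnorm_sqr real_normK ?num_real //.
apply: form_CauchySchwarz => *;
  [exact: rdotDl|exact: rdotrZl|exact: rdotC|exact: rdot_ge0].
Qed.

Lemma rnorm_le_dual x r : 0 <= r -> (forall y, rdot x y <= r * rnorm y) ->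
  rnorm x <= r.
Proof.
move=> r0 /(_ x); rewrite -rnorm_sqr expr2.
have := rnorm_ge0 x; rewrite le_eqVlt => /predU1P[<-//|x0].
by rewrite ler_pM2r.
Qed.

End RealForm.

(** * Completeness and the Riesz representation *)

Section Completeness.
Context {R : realType} {H : hilbertType R}.
Implicit Types (x y z : H) (c : R[i]) (r s : R).

Lemma normC_le_ReIm (c : R[i]) :
  complex.Re `|c| <= `|complex.Re c| + `|complex.Im c|.
Proof.
case: c => a b; rewrite normc_def /=.
rewrite -[leRHS](@ger0_norm _ (`|a| + `|b|)) ?addr_ge0 // -sqrtr_sqr.
rewrite ler_wsqrtr // sqrrD !real_normK ?num_real //.
by rewrite -addrA lerD2l lerDr mulrn_wge0 // mulr_ge0.
Qed.

Lemma wot_cvgP (I : Type) (F : set_system I) (u : I -> bop H) (T : bop H) :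
  Filter F ->
  wot_cvg F u T <-> forall x y, rdot (u i x) y @[i --> F] --> rdot (T x) y.
Proof.
move=> FF; split=> uT x y.
  apply/cvgrPdist_lt => e e0; have /cvgrPdist_lt /(_ e%:C%C) := uT x y.
  rewrite ltcR => /(_ e0); apply: filterS => i; rewrite -ltcR.
  apply: le_lt_trans; rewrite /rdot -ReN -ReD.
  exact: normc_ge_Re.
apply/cvgrPdist_lt => e e0.
have [er] : exists r, e = r%:C%C by apply/complex_realP; rewrite gtr0_real.
move=> ee; move: e0; rewrite {}ee ltcR => e0.
have e20 : 0 < er / 2 by rewrite divr_gt0.
have /cvgrPdist_lt /(_ _ e20) h1 := uT x y.
have /cvgrPdist_lt /(_ _ e20) h2 := uT x ('i%C *: y).
move: h1 h2; apply: filterS2 => i h1 h2.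
have -> : `|'[T x, y] - '[u i x, y]| =
  (complex.Re `|'[T x, y] - '[u i x, y]|)%:C%C.
  by rewrite RRe_real // ger0_real.
rewrite ltcR (le_lt_trans (normC_le_ReIm _)) // !inner_rdot /=.
by rewrite (splitr er) ltrD.
Qed.

(** Completeness with a rate, so that operators defined as pointwise limits
    come with explicit bounds. *)
Lemma hilbert_complete (u : nat -> H) (e : nat -> R) :
  e @ \oo --> 0 -> (forall n m, (n <= m)%N -> rnorm (u n - u m) <= e n) ->
  exists l, forall n, rnorm (u n - l) <= e n.
Proof.
move=> e0 ue.
have : cauchy (u @ \oo).
  apply: cauchy_exP => eps eps0.
  have [er] : exists r, eps = r%:C%C by apply/complex_realP; rewrite gtr0_real.
  move=> ee; move: eps0; rewrite {}ee ltcR => er0.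
  have /cvgrPdist_lt /(_ _ er0) [N _ hN] := e0.
  exists (u N); exists N => // m /= Nm; rewrite -ball_normE /= rnormE ltcR.
  apply: le_lt_trans (ue _ _ Nm) _.
  have := hN N (leqnn _); rewrite sub0r normrN; apply: le_lt_trans.
  exact: ler_norm.
move=> /cauchy_cvg /cvg_ex [l ul].
exists l => n; apply/ler_addgt0Pr => r r0.
have /cvgrPdist_lt /(_ r%:C%C) := ul; rewrite ltcR => /(_ r0) [N _ hN].
have := hN (maxn n N) (leq_maxr _ _); rewrite rnormE ltcR => hl.
rewrite -(subrK (u (maxn n N)) (u n)) -addrA.
apply: (le_trans (rnormD _ _)); apply: lerD; first by rewrite ue // leq_maxl.
by rewrite rnormB ltW.
Qed.

Lemma harmonic_bound_eq0 (K L : R) :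
  (forall n, `|L| <= K * n.+1%:R^-1) -> L = 0.
Proof.
move=> h; apply/eqP; apply: contraT; rewrite -normr_gt0 => L0.
have := h (Num.truncn (K / `|L|)); rewrite ler_pdivlMr ?ltr0n //.
by rewrite -ler_pdivlMl // mulrC leNgt truncnS_gt.
Qed.

Lemma parallelogram x y :
  rnorm (x - y) ^+ 2 =
  2 * rdot x x + 2 * rdot y y - rdot (x + y) (x + y).
Proof.
rewrite rnorm_sqr rdotBl !rdotBr !rdotDl !rdotDr (rdotC y x); ring.
Qed.

(** The representing vector z minimises J x = |x|^2 - 2 phi x. By the
    parallelogram identity a minimising sequence is Cauchy. The identity phi h
    = <h, z> is the vanishing of the derivative of J at z in the direction h;
    it is obtained along the sequence, without continuity of J, by moving u n
    by d n * h when u n is d n ^+ 2-close to the infimum. *)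
Lemma riesz (phi : H -> R) (M : R) :
  (forall x y, phi (x + y) = phi x + phi y) ->
  (forall r x, phi (r%:C%C *: x) = r * phi x) ->
  (forall x, `|phi x| <= M * rnorm x) ->
  exists z, forall x, phi x = rdot x z.
Proof.
move=> phiD phiZ phiM.
pose J x := rdot x x - 2 * phi x.
have JM x : - M ^+ 2 <= J x.
  rewrite /J -rnorm_sqr; have := phiM x; rewrite ler_norml => /andP[_ h].
  have := sqr_ge0 (rnorm x - M); rewrite sqrrB; lra.
have hJ : has_inf (range J).
  by split; [exists (J 0), 0|exists (- M ^+ 2) => _ [x _ <-]].
set m := inf (range J).
have Jm x : m <= J x by apply: ge_inf; [exact: hJ.2|exists x].
pose d n : R := n.+1%:R^-1.
have d0 n : 0 < d n by rewrite invr_gt0 ltr0n.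
have /choice[u hu] n : exists x, J x < m + d n ^+ 2.
  have [_ [x _ <-] hx] := inf_adherent (exprn_gt0 2 (d0 n)) hJ.
  by exists x.
(* The parallelogram identity at the midpoint, where J is at least m. *)
have half x y : J x + J y - 2 * m >= rnorm (x - y) ^+ 2 / 2.
  have := Jm ((2^-1)%:C%C *: (x + y)); rewrite /J phiZ !rdotrZl !rdotrZr phiD.
  rewrite parallelogram; lra.
have dd n k : (n <= k)%N -> d k <= d n.
  by move=> nk; rewrite lef_pV2 ?posrE ?ltr0n // ler_nat.
have ucauchy n k : (n <= k)%N -> rnorm (u n - u k) <= 2 * d n.
  move=> nk; rewrite -(@ler_pXn2r _ 2) ?nnegrE ?rnorm_ge0 ?mulr_ge0 // 1?ltW //.
  have := half (u n) (u k); have := hu n; have := hu k.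
  have : d k ^+ 2 <= d n ^+ 2 by rewrite ler_pXn2r ?nnegrE ?(ltW (d0 _)) ?dd.
  by rewrite exprMn; lra.
have d2 : (fun n => 2 * d n) @ \oo --> 0.
  by rewrite -(mulr0 2); apply: cvgMl_tmp; exact: cvg_harmonic.
have [z hz] := hilbert_complete d2 ucauchy.
exists z => h; apply/eqP; rewrite -subr_eq0; apply/eqP.
apply: (harmonic_bound_eq0 (K := 1 + rnorm h ^+ 2 + 4 * rnorm h)) => n.
have n2 : `|rdot h (u n) - rdot h z| <= rnorm h * (2 * d n).
  by rewrite -rdotBr (le_trans (rdot_CauchySchwarz _ _)) // ler_wpM2l ?rnorm_ge0.
have key t : 0 <= d n ^+ 2 + t ^+ 2 * rnorm h ^+ 2
    + 2 * t * (rdot h (u n) - phi h).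
  have := Jm (u n + t%:C%C *: h); have := hu n; rewrite /J phiD phiZ rnorm_sqr.
  rewrite rdotDl !rdotDr !rdotrZl !rdotrZr (rdotC (u n) h); lra.
rewrite -/(d n) distrC; move: n2; set L := rdot h z - phi h; set N := rnorm h.
set e := rdot h (u n) - _.
have eE : rdot h (u n) - phi h = e + L by rewrite /e /L; ring.
have k1 : 0 <= d n * (d n * (1 + N ^+ 2) + 2 * (e + L)).
  by have := key (d n); rewrite eE /N; congr (_ <= _); ring.
have k2 : 0 <= d n * (d n * (1 + N ^+ 2) - 2 * (e + L)).
  by have := key (- d n); rewrite eE /N; congr (_ <= _); ring.
move: k1 k2; rewrite !pmulr_rge0 // !ler_norml => k1 k2 /andP[e1 e2].
by apply/andP; split; lra.
Qed.
End Completeness.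

(** * Bounded operators, adjoints and positivity *)

Section Operators.
Context {R : realType} {H : hilbertType R}.
Implicit Types (x y z : H) (c : R[i]) (r s : R) (S T U : bop H).

Lemma bopDE S T x : (S + T) x = S x + T x. Proof. by []. Qed.
Lemma bopNE T x : (- T) x = - T x. Proof. by []. Qed.
Lemma bopZE c T x : (c *: T) x = c *: T x. Proof. by []. Qed.
Lemma bopME S T x : (S * T) x = S (T x). Proof. by []. Qed.
Lemma bop1E x : (1 : bop H) x = x. Proof. by []. Qed.
Lemma bop0E x : (0 : bop H) x = 0. Proof. by []. Qed.

Lemma bop_linD T x y : T (x + y) = T x + T y.
Proof. by have := bop_linear T 1 x y; rewrite !scale1r. Qed.

Lemma bop_lin0 T : T 0 = 0.
Proof. by apply: (addrI (T 0)); rewrite -bop_linD !addr0. Qed.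

Lemma bop_linZ T c x : T (c *: x) = c *: T x.
Proof. by have := bop_linear T c x 0; rewrite bop_lin0 !addr0. Qed.

Lemma bop_ext S T : (forall x, S x = T x) -> S = T.
Proof. by move=> e; apply/val_inj/funext. Qed.

Lemma rdot_ext S T : (forall x y, rdot (S x) y = rdot (T x) y) -> S = T.
Proof. by move=> e; apply: bop_ext => x; apply: rdot_eq. Qed.

Lemma scaleMl c S T : c *: S * T = c *: (S * T). Proof. exact: bop_ext. Qed.

Lemma scaleMr c S T : S * (c *: T) = c *: (S * T).
Proof. by apply: bop_ext => x; rewrite bopME bopZE bop_linZ. Qed.

Definition bounded_by T r := forall x, rnorm (T x) <= r * rnorm x.

Lemma bop_linN T x : T (- x) = - T x.
Proof. by rewrite -scaleN1r bop_linZ scaleN1r. Qed.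

Lemma bounded_byN T M : bounded_by T M -> bounded_by (- T) M.
Proof. by move=> TM x; rewrite bopNE rnormN. Qed.

Lemma bounded_by_ex T : exists2 M, 0 < M & bounded_by T M.
Proof.
case/bounded_operatorP: (valP T) => _ [c c0 hc].
have [r cE] : exists r, c = r%:C%C by apply/complex_realP; rewrite ger0_real.
move: hc c0; rewrite {}cE ler0c => hc r0.
exists (r + 1) => [|x]; first by rewrite ltr_wpDl.
have := hc x; rewrite !rnormE -rmorphM lecR => /le_trans; apply.
by rewrite ler_wpM2r ?rnorm_ge0 // lerDl.
Qed.

Lemma bop_of_real (f : H -> H) M : 0 <= M ->
  (forall c x y, f (c *: x + y) = c *: f x + f y) ->
  (forall x, rnorm (f x) <= M * rnorm x) -> exists T : bop H, forall x, T x = f x.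
Proof.
move=> M0 lf fM.
suff fb : f \in bounded_operator by exists (Bop fb).
apply/bounded_operatorP; split; first exact: lf.
exists M%:C%C; first by rewrite ler0c.
by move=> x; rewrite !rnormE -rmorphM lecR.
Qed.

(** A bounded sesquilinear form comes from an operator. Only its real part B
    is given, so sesquilinearity is the rule that a complex scalar moves
    across B with a conjugation. *)
Lemma operator_of_form (B : H -> H -> R) M : 0 <= M ->
  (forall c x y z, B (c *: x + y) z = B x (conjc c *: z) + B y z) ->
  (forall r x y z, B x (r%:C%C *: y + z) = r * B x y + B x z) ->
  (forall x y, `|B x y| <= M * rnorm x * rnorm y) ->
  exists T : bop H, forall x y, rdot (T x) y = B x y.
Proof.
move=> M0 Bl Br BM.
have Br0 x : B x 0 = 0.
  by apply/eqP; rewrite -normr_le0 (le_trans (BM _ _)) // /rnorm normr0 mulr0.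
have /choice[f hf] x : exists z, forall y, B x y = rdot y z.
  apply: (@riesz _ _ (B x) (M * rnorm x)) => [y z|r y|y]; last exact: BM.
    by have := Br 1 x y z; rewrite scale1r mul1r.
  by have := Br r x y 0; rewrite !addr0 Br0 addr0.
have fB x y : rdot (f x) y = B x y by rewrite hf rdotC.
have [T hT] : exists T : bop H, forall x, T x = f x.
  apply: (bop_of_real M0) => [c x y|x].
    by apply: rdot_eq => z; rewrite rdotDl rdotZl !fB Bl.
  apply: rnorm_le_dual => [|y]; first by rewrite mulr_ge0 ?rnorm_ge0.
  by rewrite fB (le_trans (ler_norm _)) // BM.
by exists T => x y; rewrite hT fB.
Qed.

Lemma adj_inner S T :
  (forall x y, rdot (T x) y = rdot x (S y)) -> forall x y, '[T x, y] = '[x, S y].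
Proof.
by move=> TS x y; apply: inner_rdotP => c; rewrite TS bop_linZ.
Qed.

(** The adjoint is selected by a choice operator, so its defining equation
    needs the existence of an operator that satisfies it. *)
Lemma adjP T x y : rdot (T x) y = rdot x (adj T y).
Proof.
suff : (exists S, forall x y, rdot (T x) y = rdot x (S y)).
  move=> [S /adj_inner TS]; rewrite /rdot; congr complex.Re; move: x y.
  exact: (xgetPex (P := [set S : bop H | forall x y, '[T x, y] = '[x, S y]]) 0
    (ex_intro _ S TS)).
have [M M0 TM] := bounded_by_ex T.
have [S hS] : exists S : bop H, forall x y, rdot (S x) y = rdot x (T y).
  apply: (operator_of_form (M := M)); first exact: ltW.
  - by move=> c u v w; rewrite rdotDl rdotZl bop_linZ.
  - by move=> r u v w; rewrite bop_linD bop_linZ rdotDr rdotrZr.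
  - move=> u v; rewrite (le_trans (rdot_CauchySchwarz _ _)) // -mulrA mulrCA.
    by rewrite ler_wpM2l ?rnorm_ge0.
by exists S => u v; rewrite rdotC -hS rdotC.
Qed.

Lemma adjPr T x y : rdot (adj T x) y = rdot x (T y).
Proof. by rewrite rdotC -adjP rdotC. Qed.

Lemma adj_uniq S T : (forall x y, rdot (T x) y = rdot x (S y)) -> adj T = S.
Proof. by move=> TS; apply: rdot_ext => x y; rewrite adjPr rdotC TS rdotC. Qed.

Lemma adj1 : adj 1 = 1 :> bop H. Proof. exact: adj_uniq. Qed.

Lemma adjM S T : adj (S * T) = adj T * adj S.
Proof. by apply: adj_uniq => x y; rewrite !bopME !adjP. Qed.

Lemma adj_bounded_by T M : 0 <= M -> bounded_by T M -> bounded_by (adj T) M.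
Proof.
move=> M0 TM x; apply: rnorm_le_dual; first by rewrite mulr_ge0 ?rnorm_ge0.
move=> y; rewrite adjPr (le_trans (ler_norm _)) //.
rewrite (le_trans (rdot_CauchySchwarz _ _)) //.
by rewrite -mulrA (mulrC M) -mulrA ler_wpM2l ?rnorm_ge0 // mulrC.
Qed.

Definition selfadjoint T := forall x y, rdot (T x) y = rdot x (T y).

Lemma mulii : 'i%C * 'i%C = -1 :> R[i].
Proof. by rewrite -expr2 sqr_i. Qed.

Lemma conjci : conjc 'i%C = - 'i%C :> R[i].
Proof. by congr (_ +i* _)%C; rewrite oppr0. Qed.

Lemma rdotii x y : rdot ('i%C *: x) ('i%C *: y) = rdot x y.
Proof.
by rewrite rdotZl scalerA conjci mulNr mulii opprK scale1r.
Qed.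

(** Over the complex numbers a form with real values on the diagonal is
    hermitian, so positivity includes self-adjointness. Conversely <Tx, x> is
    real as soon as T is self-adjoint. *)
Lemma posopP T : posop T <-> selfadjoint T /\ forall x, 0 <= rdot (T x) x.
Proof.
split=> [T0|[Ts T0] x]; last first.
  rewrite inner_rdot lecE /= T0 andbT; apply/eqP.
  have : rdot (T x) ('i%C *: x) = - rdot (T x) ('i%C *: x).
    by rewrite {1}Ts bop_linZ rdotC rdotZl conjci scaleNr rdotNr.
  lra.
have T0r x : 0 <= rdot (T x) x.
  by have := T0 x; rewrite inner_rdot lecE /= => /andP[].
split=> // x y.
have Ti u : rdot (T u) ('i%C *: u) = 0.
  by have := T0 u; rewrite inner_rdot lecE /= => /andP[/eqP].
(* Polarisation of the diagonal condition, at i y + x. *)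
have := Ti ('i%C *: y + x); rewrite bop_linD rdotDl !scalerDr !rdotDr !Ti.
rewrite bop_linZ rdotii scalerA mulii.
rewrite scaleN1r rdotNr (rdotC x); lra.
Qed.

Lemma posop_selfadjoint T : posop T -> selfadjoint T. Proof. by case/posopP. Qed.

Lemma posop_ge0 T x : posop T -> 0 <= rdot (T x) x. Proof. by case/posopP. Qed.

Lemma selfadjointD S T : selfadjoint S -> selfadjoint T -> selfadjoint (S + T).
Proof. by move=> hS hT x y; rewrite !bopDE rdotDl rdotDr hS hT. Qed.

Lemma selfadjointN T : selfadjoint T -> selfadjoint (- T).
Proof. by move=> hT x y; rewrite !bopNE rdotNl rdotNr hT. Qed.

Lemma selfadjointZ r T : selfadjoint T -> selfadjoint (r%:C%C *: T).
Proof. by move=> hT x y; rewrite !bopZE rdotrZl rdotrZr hT. Qed.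

Lemma selfadjoint1 : selfadjoint (1 : bop H). Proof. by []. Qed.

Lemma posop1 : posop (1 : bop H).
Proof. by apply/posopP; split=> // x; exact: rdot_ge0. Qed.

Lemma posop0 : posop (0 : bop H).
Proof. by apply/posopP; split=> [x y|x]; rewrite !bop0E ?rdot0l ?rdot0r. Qed.

Lemma posopD (S T : bop H) : posop S -> posop T -> posop (S + T).
Proof.
move=> /posopP[Ss S0] /posopP[Ts T0]; apply/posopP; split; first exact: selfadjointD.
by move=> x; rewrite bopDE rdotDl addr_ge0.
Qed.

Lemma posopZ r (T : bop H) : 0 <= r -> posop T -> posop (r%:C%C *: T).
Proof.
move=> r0 /posopP[Ts T0]; apply/posopP; split; first exact: selfadjointZ.
by move=> x; rewrite bopZE rdotrZl mulr_ge0.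
Qed.

Lemma leopP S T : selfadjoint S -> selfadjoint T ->
  leop S T <-> forall x, rdot (S x) x <= rdot (T x) x.
Proof.
move=> hS hT; rewrite /leop; split=> [/posopP[_ h] x|h].
  by have := h x; rewrite bopDE bopNE rdotBl subr_ge0.
apply/posopP; split=> [|x]; first by apply/selfadjointD => //; exact: selfadjointN.
by rewrite bopDE bopNE rdotBl subr_ge0.
Qed.

Lemma posop_CauchySchwarz T x y : posop T ->
  rdot (T x) y ^+ 2 <= rdot (T x) x * rdot (T y) y.
Proof.
move=> /posopP[Ts T0].
apply: (form_CauchySchwarz (F := fun u v => rdot (T u) v)) => //.
- by move=> u v w; rewrite bop_linD rdotDl.
- by move=> r u v; rewrite bop_linZ rdotrZl.
- by move=> u v; rewrite Ts rdotC.
Qed.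

(** A positive operator is controlled by its quadratic form; this is how order
    bounds become norm bounds. *)
Lemma posop_form_le T M : 0 <= M -> posop T ->
  (forall x, rdot (T x) x <= M * rdot x x) ->
  forall x y, `|rdot (T x) y| <= M * rnorm x * rnorm y.
Proof.
move=> M0 T0 TM x y; rewrite -(@ler_pXn2r _ 2) ?nnegrE ?mulr_ge0 ?rnorm_ge0 //.
rewrite real_normK ?num_real // (le_trans (posop_CauchySchwarz _ _ T0)) //.
have -> : (M * rnorm x * rnorm y) ^+ 2 = (M * rdot x x) * (M * rdot y y).
  by rewrite -!rnorm_sqr; ring.
by apply: ler_pM => //; exact: posop_ge0.
Qed.

Lemma form_bounded_by T M : 0 <= M ->
  (forall x y, `|rdot (T x) y| <= M * rnorm x * rnorm y) -> bounded_by T M.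
Proof.
move=> M0 TM x; apply: rnorm_le_dual; first by rewrite mulr_ge0 ?rnorm_ge0.
by move=> y; rewrite (le_trans (ler_norm _)).
Qed.

Lemma posop_bounded_by T M : 0 <= M -> posop T ->
  (forall x, rdot (T x) x <= M * rdot x x) -> bounded_by T M.
Proof. by move=> M0 T0 TM; apply: form_bounded_by => //; exact: posop_form_le. Qed.

Lemma bounded_by_form T M x : bounded_by T M -> `|rdot (T x) x| <= M * rdot x x.
Proof.
move=> TM; rewrite (le_trans (rdot_CauchySchwarz _ _)) // -rnorm_sqr expr2 mulrA.
by rewrite ler_wpM2r ?rnorm_ge0.
Qed.

Lemma selfadjoint_polarization T x y : selfadjoint T ->
  rdot (T x) y = (rdot (T (x + y)) (x + y) - rdot (T (x - y)) (x - y)) / 4.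
Proof.
move=> Ts; rewrite !bop_linD !bop_linN !rdotBl !rdotBr.
rewrite !rdotDl !rdotDr (Ts y x) (rdotC y (T x)); by field.
Qed.

Lemma selfadjoint_ext S T : selfadjoint S -> selfadjoint T ->
  (forall x, rdot (S x) x = rdot (T x) x) -> S = T.
Proof.
move=> hS hT e; apply: rdot_ext => x y.
by rewrite (selfadjoint_polarization x y hS) (selfadjoint_polarization x y hT) !e.
Qed.

(** Real and imaginary parts of T, each shifted by M to become positive. *)
Lemma posop_decomposition T M : 0 <= M -> bounded_by T M -> exists P Q : bop H,
  [/\ posop P, posop Q, forall x, rdot (P x) x <= 2 * M * rdot x x,
      forall x, rdot (Q x) x <= 2 * M * rdot x x &
      T = P - M%:C%C *: (1 : bop H) + 'i%C *: (Q - M%:C%C *: (1 : bop H))].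
Proof.
move=> M0 TM.
have Ti : bounded_by ('i%C *: T) M by move=> x; rewrite bopZE rnormi.
have half S : bounded_by S M ->
   posop ((2^-1)%:C%C *: (S + adj S) + M%:C%C *: (1 : bop H)) /\
   forall x, rdot (((2^-1)%:C%C *: (S + adj S) + M%:C%C *: (1 : bop H)) x) x
        <= 2 * M * rdot x x.
  move=> SM.
  have e x : rdot (((2^-1)%:C%C *: (S + adj S) + M%:C%C *: (1 : bop H)) x) x =
      rdot (S x) x + M * rdot x x.
    rewrite bopDE !bopZE bopDE bop1E rdotDl !rdotrZl rdotDl adjPr.
    by rewrite (rdotC x); field.
  have SMx x := bounded_by_form x SM.
  split=> [|x]; last by have := SMx x; rewrite e ler_norml; lra.
  apply/posopP; split=> [|x]; last by have := SMx x; rewrite e ler_norml; lra.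
  apply: selfadjointD; last exact/selfadjointZ/selfadjoint1.
  apply: selfadjointZ => x y; rewrite !bopDE rdotDl rdotDr adjP adjPr; ring.
have [P0 PM] := half _ TM; have [Q0 QM] := half (- ('i%C *: T)) (bounded_byN Ti).
eexists; eexists; split; [exact: P0|exact: Q0|exact: PM|exact: QM|].
rewrite !addrK; apply: rdot_ext => x y.
rewrite bopDE rdotDl (bopZE 'i%C) rdotZl conjci scaleNr.
rewrite !bopZE !bopDE !rdotrZl !rdotDl !adjPr !bopNE !bopZE rdotNl !rdotNr rdotii.
rewrite bop_linN bop_linZ scalerN rdotNr scalerA mulii.
by rewrite scaleN1r !rdotNr; field.
Qed.
End Operators.

(** * Weak limits of operators *)

Section WotLimits.
Context {R : realType} {H : hilbertType R}.
Implicit Types (x y z : H) (c : R[i]) (r s : R) (S T U : bop H).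

Lemma cvg_eq_unique (I : Type) (F : set_system I) (f g : I -> R) (a b : R) :
  ProperFilter F -> (forall i, f i = g i) ->
  f @ F --> a -> g @ F --> b -> a = b.
Proof.
move=> FF /funext-> fa fb.
exact: (cvg_unique (@norm_hausdorff _ R^o) fa fb).
Qed.

Lemma wot_cvg_unique (I : Type) (F : set_system I) (u : I -> bop H) S T :
  ProperFilter F -> wot_cvg F u S -> wot_cvg F u T -> S = T.
Proof.
move=> FF /wot_cvgP uS /wot_cvgP uT; apply: rdot_ext => x y.
exact: (cvg_eq_unique _ (fun=> erefl) (uS x y) (uT x y)).
Qed.

Lemma wot_cvg_linear (I : Type) (F : set_system I) (u v : I -> bop H) c S T :
  Filter F -> wot_cvg F u S -> wot_cvg F v T ->
  wot_cvg F (fun i => c *: u i + v i) (c *: S + T).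
Proof.
move=> FF /wot_cvgP uS /wot_cvgP uT; apply/wot_cvgP => x y.
rewrite bopDE bopZE rdotDl rdotZl; under eq_fun do rewrite bopDE bopZE rdotDl rdotZl.
exact: cvgD.
Qed.

Lemma wot_cvg_mul (I : Type) (F : set_system I) (u : I -> bop H) S T U :
  Filter F -> wot_cvg F u S ->
  wot_cvg F (fun i => T * u i * U) (T * S * U).
Proof.
move=> FF /wot_cvgP uS; apply/wot_cvgP => x y; rewrite !bopME adjP.
by under eq_fun do rewrite !bopME adjP; exact: uS.
Qed.

Lemma wot_selfadjoint (I : Type) (F : set_system I) (u : I -> bop H) S :
  ProperFilter F -> (forall i, selfadjoint (u i)) -> wot_cvg F u S -> selfadjoint S.
Proof.
move=> FF us /wot_cvgP uS x y; rewrite (rdotC x).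
by apply: (cvg_eq_unique _ _ (uS x y) (uS y x)) => i; rewrite us rdotC.
Qed.

(** Weak compactness in the form needed here: for a bounded family of positive
    operators it is enough that the quadratic forms converge. Polarisation
    gives convergence of the forms, and the limit form is bounded, hence comes
    from an operator. *)
Lemma wot_cvg_posop (I : Type) (F : set_system I) (u : I -> bop H) M :
  ProperFilter F -> 0 <= M -> (forall i, posop (u i)) ->
  (forall i x, rdot (u i x) x <= M * rdot x x) ->
  (forall x, cvg (rdot (u i x) x @[i --> F])) ->
  exists2 T, posop T & wot_cvg F u T.
Proof.
move=> FF M0 u0 uM ucvg.
have us i := posop_selfadjoint (u0 i).
have uc x y : cvg (rdot (u i x) y @[i --> F]).
  under eq_fun => i do rewrite (selfadjoint_polarization x y (us i)).
  by apply: is_cvgMr_tmp; apply: is_cvgB.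
pose B x y := lim (rdot (u i x) y @[i --> F]).
have uB x y : rdot (u i x) y @[i --> F] --> B x y by exact: uc.
have [T hT] : exists T : bop H, forall x y, rdot (T x) y = B x y.
  apply: (operator_of_form M0) => [c x y z|r x y z|x y].
  - apply: (cvg_eq_unique _ _ (uB _ _) (cvgD (uB _ _) (uB _ _))) => i /=.
    by rewrite bop_linD bop_linZ rdotDl rdotZl.
  - have h : r * rdot (u i x) y + rdot (u i x) z @[i --> F]
        --> r * B x y + B x z.
      by apply: cvgD; [apply: cvgMl_tmp|]; exact: uB.
    by apply: (cvg_eq_unique _ _ (uB _ _) h) => i; rewrite rdotDr rdotrZr.
  - apply: (cvgr_to_le (cvg_norm (uB x y))); apply: nearW => i.
    exact: posop_form_le.
have uT : wot_cvg F u T by apply/wot_cvgP => x y; rewrite hT; exact: uB.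
exists T => //; apply/posopP; split=> [|x]; first exact: wot_selfadjoint uT.
by rewrite hT; apply: (cvgr_to_ge (uB x x)); apply: nearW => i; exact: posop_ge0.
Qed.

End WotLimits.

#[local] Existing Instance totally_filter.

Section FsetSums.
Context {R : realType} {W : choiceType}.
Implicit Types (A B : {fset W}).

Lemma partial_sum_le (g : W -> R) A B : (forall w, 0 <= g w) ->
  (A `<=` B)%fset -> partial_sum g A <= partial_sum g B.
Proof.
move=> g0 AB; rewrite /partial_sum -!(big_seq_fsetE _ _ predT) /=.
rewrite (big_fsetID _ (mem A) B) /=.
have -> : [fset x in B | x \in A]%fset = A.
  by apply/fsetP => x; rewrite !inE andbC; apply: andb_idr => /(fsubsetP AB).
by rewrite lerDl sumr_ge0.
Qed.

(** Unordered sums of nonnegative terms converge to the supremum of the finite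
    sums. *)
Lemma totally_mono_cvg (g : {fset W} -> R) K :
  (forall A B, (A `<=` B)%fset -> g A <= g B) -> (forall A, g A <= K) ->
  g @ totally --> sup (range g).
Proof.
move=> gm gK.
have hg : has_sup (range g).
  by split; [exists (g fset0); exists fset0|exists K => _ [A _ <-]].
apply/cvgrPdist_lt => e e0.
have [_ [A _ <-] hA] := sup_adherent e0 hg.
exists A => // B /= AB; rewrite ger0_norm; last first.
  by rewrite subr_ge0; apply: ub_le_sup; [exact: hg.2|exists B].
by have := gm _ _ AB; lra.
Qed.

Lemma totally_mono_le (g : {fset W} -> R) (l : R) :
  (forall A B, (A `<=` B)%fset -> g A <= g B) -> g @ totally --> l ->
  forall A, g A <= l.
Proof.
move=> gm gl A; apply: (cvgr_to_ge gl).
by exists A => // B /= AB; exact: gm.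
Qed.

End FsetSums.

(** * The map Phi *)

Section LinearMaps.
Context {K : pzRingType} {V W : lmodType K} (f : V -> W) (fl : linear f).

Lemma lin_map0 : f 0 = 0.
Proof. by apply: (addrI (f 0)); have := fl 1 0 0; rewrite !scale1r !addr0. Qed.

Lemma lin_mapZ c x : f (c *: x) = c *: f x.
Proof. by have := fl c x 0; rewrite lin_map0 !addr0. Qed.

Lemma lin_mapD x y : f (x + y) = f x + f y.
Proof. by have := fl 1 x y; rewrite !scale1r. Qed.

Lemma lin_mapB x y : f (x - y) = f x - f y.
Proof. by rewrite -scaleN1r lin_mapD lin_mapZ scaleN1r. Qed.

End LinearMaps.

Section PhiTheory.
Context {R : realType} {n : nat} {H : hilbertType R}.
Context (a : seq 'I_n -> R) (X : 'I_n -> bop H).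
Context (a0 : forall w, 0 <= a w).
Implicit Types (Y Z P S T : bop H) (w : seq 'I_n).

Definition coef w : R := if (0 < size w)%N then a w else 0.

Lemma coef_ge0 w : 0 <= coef w.
Proof. by rewrite /coef; case: ifP. Qed.

Lemma Phi_termE Y w : Phi_term a X Y w =
  (coef w)%:C%C *: (word_eval X w * Y * adj (word_eval X w)).
Proof. by rewrite /Phi_term /coef; case: ifP => // _; rewrite scale0r. Qed.

Lemma rdot_Phi_term Y w x y : rdot (Phi_term a X Y w x) y =
  coef w * rdot (Y (adj (word_eval X w) x)) (adj (word_eval X w) y).
Proof. by rewrite Phi_termE bopZE rdotrZl !bopME adjP. Qed.

Lemma rdot_partial_Phi Y A x y : rdot (partial_sum (Phi_term a X Y) A x) y =
  partial_sum (fun w =>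
    coef w * rdot (Y (adj (word_eval X w) x)) (adj (word_eval X w) y)) A.
Proof.
rewrite /partial_sum (big_morph (fun T : bop H => rdot (T x) y)
  (id1 := 0) (op1 := +%R)) => [|S T|]; last by rewrite bop0E rdot0l.
  by apply: eq_bigr => i _; rewrite rdot_Phi_term.
by rewrite bopDE rdotDl.
Qed.

Lemma partial_Phi_linear c Y Z A : partial_sum (Phi_term a X (c *: Y + Z)) A =
  c *: partial_sum (Phi_term a X Y) A + partial_sum (Phi_term a X Z) A.
Proof.
rewrite /partial_sum scaler_sumr -big_split; apply: eq_bigr => i _ /=.
rewrite !Phi_termE mulrDr mulrDl scaleMr scaleMl scalerDr !scalerA.
by rewrite (mulrC c).
Qed.

Lemma partial_Phi_pos P A : posop P -> posop (partial_sum (Phi_term a X P) A).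
Proof.
move=> P0; apply/posopP; split=> [x y|x].
  rewrite (rdotC x) !rdot_partial_Phi; apply: eq_bigr => i _.
  by rewrite (posop_selfadjoint P0) rdotC.
rewrite rdot_partial_Phi; apply: sumr_ge0 => i _.
by rewrite mulr_ge0 ?coef_ge0 ?posop_ge0.
Qed.

Lemma partial_Phi_mono P x : posop P -> forall A B, (A `<=` B)%fset ->
  rdot (partial_sum (Phi_term a X P) A x) x <=
  rdot (partial_sum (Phi_term a X P) B x) x.
Proof.
move=> P0 A B AB; rewrite !rdot_partial_Phi; apply: partial_sum_le => // w.
by rewrite mulr_ge0 ?coef_ge0 ?posop_ge0.
Qed.

Lemma partial_Phi_le P x Z : posop P -> Phi_sum a X P Z -> forall A,
  rdot (partial_sum (Phi_term a X P) A x) x <= rdot (Z x) x.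
Proof.
move=> P0 /wot_cvgP PZ; apply: totally_mono_le; first exact: partial_Phi_mono.
exact: PZ.
Qed.

(** For P <= M the finite sums increase and stay below M times the sum at the
    identity. *)
Lemma Phi_sum_pos_ex P : Phi_summable a X -> posop P ->
  exists2 T, posop T & Phi_sum a X P T.
Proof.
move=> [Z Z1] P0.
have [M M0 PM] := bounded_by_ex P; have [N N0 ZN] := bounded_by_ex Z.
have PSb A x : rdot (partial_sum (Phi_term a X P) A x) x <= M * N * rdot x x.
  apply: (@le_trans _ _ (M * rdot (partial_sum (Phi_term a X 1) A x) x)).
    rewrite !rdot_partial_Phi /partial_sum mulr_sumr; apply: ler_sum => i _.
    rewrite mulrCA ler_wpM2l ?coef_ge0 //.
    by rewrite (le_trans (ler_norm _)) // bounded_by_form.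
  rewrite -mulrA ler_wpM2l ?(ltW M0) // (le_trans (partial_Phi_le x posop1 Z1 A)) //.
  by rewrite (le_trans (ler_norm _)) // bounded_by_form.
apply: (wot_cvg_posop (M := M * N)) => //.
- by rewrite mulr_ge0 // ltW.
- by move=> A; exact: partial_Phi_pos.
- move=> x; apply: cvgP; apply: totally_mono_cvg; first exact: partial_Phi_mono.
  by move=> A; exact: PSb.
Qed.

Lemma Phi_sum_lin c Y Z S T : Phi_sum a X Y S -> Phi_sum a X Z T ->
  Phi_sum a X (c *: Y + Z) (c *: S + T).
Proof.
move=> YS ZT; rewrite /Phi_sum.
have -> : partial_sum (Phi_term a X (c *: Y + Z)) = fun A =>
    c *: partial_sum (Phi_term a X Y) A + partial_sum (Phi_term a X Z) A.
  by apply/funext => A; exact: partial_Phi_linear.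
exact: (wot_cvg_linear _ YS ZT).
Qed.

Lemma Phi_sum_ex Y : Phi_summable a X -> exists Z, Phi_sum a X Y Z.
Proof.
move=> hX; have [M M0 YM] := bounded_by_ex Y.
have [P [Q [P0 Q0 _ _ ->]]] := posop_decomposition (ltW M0) YM.
have [S _ PS] := Phi_sum_pos_ex hX P0; have [T _ QT] := Phi_sum_pos_ex hX Q0.
have [Z Z1] := hX.
have sub P' S' : Phi_sum a X P' S' ->
    Phi_sum a X (P' - M%:C%C *: (1 : bop H)) (- M%:C%C *: Z + S').
  by move=> h; rewrite addrC -scaleNr; exact: Phi_sum_lin.
exists ('i%C *: (- M%:C%C *: Z + T) + (- M%:C%C *: Z + S)).
by rewrite addrC; apply: Phi_sum_lin; exact: sub.
Qed.

Lemma Phi_sum_uniq Y S T : Phi_sum a X Y S -> Phi_sum a X Y T -> S = T.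
Proof. exact: wot_cvg_unique. Qed.

Context (hX : Phi_summable a X).

Lemma PhiP Y : Phi_sum a X Y (Phi a X Y).
Proof.
exact: (xgetPex (P := [set Z | Phi_sum a X Y Z]) 0 (Phi_sum_ex Y hX)).
Qed.

Lemma Phi_eq Y Z : Phi_sum a X Y Z -> Phi a X Y = Z.
Proof. by move=> YZ; apply: Phi_sum_uniq YZ; exact: PhiP. Qed.

Lemma Phi_lin c Y Z : Phi a X (c *: Y + Z) = c *: Phi a X Y + Phi a X Z.
Proof. by apply: Phi_eq; apply: Phi_sum_lin; exact: PhiP. Qed.

Lemma Phi_pos P : posop P -> posop (Phi a X P).
Proof. by move=> P0; have [T T0 /Phi_eq ->] := Phi_sum_pos_ex hX P0. Qed.

(** Uniformly in 0 <= Y <= d, the tail of the series of Phi Y is at most d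
    times the tail of the series of Phi 1, by positivity of the tail applied
    to d - Y. A finite part of the series is weakly continuous. *)
Lemma Phi_normal (I : Type) (F : set_system I) (u : I -> bop H) S d :
  ProperFilter F -> 0 <= d -> (forall i, posop (u i)) ->
  (forall i x, rdot (u i x) x <= d * rdot x x) -> posop S ->
  (forall x, rdot (S x) x <= d * rdot x x) -> wot_cvg F u S ->
  forall x, rdot (Phi a X (u i) x) x @[i --> F] --> rdot (Phi a X S x) x.
Proof.
move=> FF d0 u0 ud S0 Sd uS x.
pose tail A := rdot (Phi a X 1 x) x - rdot (partial_sum (Phi_term a X 1) A x) x.
have tailP P A : posop P -> (forall x, rdot (P x) x <= d * rdot x x) ->
  `|rdot (Phi a X P x) x - rdot (partial_sum (Phi_term a X P) A x) x|
    <= d * tail A.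
  move=> P0 Pd; rewrite ger0_norm ?subr_ge0; last first.
    exact: partial_Phi_le P0 (@PhiP P) _.
  have D0 : posop (d%:C%C *: (1 : bop H) - P).
    apply/posopP; split=> [|y]; last first.
      by rewrite bopDE bopNE bopZE rdotBl rdotrZl subr_ge0.
    apply: selfadjointD; first exact/selfadjointZ/selfadjoint1.
    exact/selfadjointN/posop_selfadjoint.
  have := partial_Phi_le x D0 (@PhiP _) A.
  have PSl : linear (fun Y => partial_sum (Phi_term a X Y) A).
    by move=> c Y Z; exact: partial_Phi_linear.
  rewrite (lin_mapB PSl) (lin_mapZ PSl) (lin_mapB Phi_lin) (lin_mapZ Phi_lin).
  by rewrite !bopDE !bopNE !bopZE !rdotBl !rdotrZl /tail; lra.
(* Dividing by d + 1 rather than d covers d = 0. *)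
have tail0 e : 0 < e -> exists A, d * tail A < e.
  move=> e0; have /wot_cvgP := @PhiP 1.
  move=> /(_ x x) /cvgrPdist_lt /(_ (e / (d + 1))).
  rewrite divr_gt0 // ?ltr_wpDl // => /(_ isT) [A _ hA].
  exists A; have := hA A (fsubset_refl A); rewrite -/(tail A) ltr_pdivlMr ?ltr_wpDl //.
  have := ler_norm (tail A); have := normr_ge0 (tail A); nra.
apply/cvgrPdist_lt => e e0.
have [A tA] := tail0 _ (divr_gt0 e0 (ltr0Sn R 2)).
have : rdot (partial_sum (Phi_term a X (u i)) A x) x @[i --> F] -->
       rdot (partial_sum (Phi_term a X S) A x) x.
  rewrite rdot_partial_Phi; under eq_fun do rewrite rdot_partial_Phi.
  apply: cvg_big; [exact: add_continuous|move=> w _; apply: cvgMl_tmp].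
  by have /wot_cvgP := uS; exact.
move=> /cvgrPdist_lt /(_ _ (divr_gt0 e0 (ltr0Sn R 2))).
apply: filterS => i; have := tailP (u i) A (u0 i) (ud i).
have := tailP S A S0 Sd; rewrite !ltr_norml !ler_norml; lra.
Qed.

End PhiTheory.

(** * Similarity *)

Section Similarity.
Context {R : realType} {n : nat} {H : hilbertType R}.
Context (a : seq 'I_n -> R) (A T : 'I_n -> bop H) (U V : bop H).
Context (a0 : forall w, 0 <= a w) (UV : U * V = 1) (VU : V * U = 1).
Context (TA : forall i, T i = U * A i * V).
Context (hA : Phi_summable a A).

(** The inner factors V * U cancel along a word; U * V = 1 is what the empty
    word needs. *)
Lemma word_eval_sim w : word_eval T w = U * word_eval A w * V.
Proof.
rewrite /word_eval; elim: w => [|i w IH]; first by rewrite !big_nil mulr1.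
by rewrite !big_cons IH TA !mulrA -(mulrA _ V U) VU mulr1.
Qed.

Lemma Phi_term_sim Z w :
  Phi_term a T Z w = U * Phi_term a A (V * Z * adj V) w * adj U.
Proof.
rewrite !Phi_termE scaleMr scaleMl word_eval_sim !adjM.
by congr (_ *: _); rewrite !mulrA.
Qed.

Lemma Phi_sum_sim Z W :
  Phi_sum a A (V * Z * adj V) W -> Phi_sum a T Z (U * W * adj U).
Proof.
move=> ZW; rewrite /Phi_sum.
have -> : partial_sum (Phi_term a T Z) = fun F =>
    U * partial_sum (Phi_term a A (V * Z * adj V)) F * adj U.
  apply/funext => F; rewrite /partial_sum mulr_sumr mulr_suml.
  by apply: eq_bigr => i _; exact: Phi_term_sim.
by have := wot_cvg_mul (T := U) (U := adj U) _ ZW; apply.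
Qed.

Lemma Phi_summable_sim : Phi_summable a T.
Proof. by eexists; apply: Phi_sum_sim; exact: PhiP. Qed.

Lemma Phi_sim Z : Phi a T Z = U * Phi a A (V * Z * adj V) * adj U.
Proof.
apply: Phi_eq => //; first exact: Phi_summable_sim.
by apply: Phi_sum_sim; exact: PhiP.
Qed.

Lemma iter_Phi_sim k Z :
  iter k (Phi a T) Z = U * iter k (Phi a A) (V * Z * adj V) * adj U.
Proof.
elim: k => [|k IH] /=.
  by rewrite !mulrA UV mul1r -mulrA -adjM UV adj1 mulr1.
rewrite IH Phi_sim; congr (_ * Phi a A _ * _).
by rewrite !mulrA VU mul1r -mulrA -adjM VU adj1 mulr1.
Qed.

Lemma ncpoly_eval_sim p : ncpoly_eval T p = U * ncpoly_eval A p * V.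
Proof.
rewrite /ncpoly_eval mulr_sumr mulr_suml; apply: eq_bigr => w _.
by rewrite scaleMr scaleMl word_eval_sim.
Qed.

End Similarity.

(** * Geometrically convergent sequences of operators *)

Section GeometricSeries.
Context {R : realType} {H : hilbertType R}.
Implicit Types (x y z : H) (c : R[i]) (r s : R) (S T X Q : bop H).

Lemma geometric_bound_eq0 (K r L : R) : 0 <= r < 1 ->
  (forall k, `|L| <= K * r ^+ k) -> L = 0.
Proof.
move=> /andP[r0 r1] h; apply/eqP; rewrite -normr_le0.
have : K * r ^+ k @[k --> \oo] --> K * 0.
  by apply: cvgMl_tmp; apply: cvg_expr; rewrite ger0_norm.
by rewrite mulr0 => /cvgr_to_ge; apply; apply: nearW.
Qed.

Lemma bounded_by_le T r s : r <= s -> bounded_by T r -> bounded_by T s.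
Proof.
by move=> rs Tr x; rewrite (le_trans (Tr x)) // ler_wpM2r ?rnorm_ge0.
Qed.

Lemma bounded_by1 : bounded_by (1 : bop H) 1.
Proof. by move=> x; rewrite mul1r. Qed.

Lemma bounded_byD S T r s : bounded_by S r -> bounded_by T s ->
  bounded_by (S + T) (r + s).
Proof.
by move=> hS hT x; rewrite bopDE (le_trans (rnormD _ _)) // mulrDl lerD.
Qed.

Lemma bounded_byM S T r s : 0 <= r -> bounded_by S r -> bounded_by T s ->
  bounded_by (S * T) (r * s).
Proof.
by move=> r0 hS hT x; rewrite bopME (le_trans (hS _)) // -mulrA ler_wpM2l.
Qed.

Lemma bounded_byZ r T s : 0 <= r -> bounded_by T s ->
  bounded_by (r%:C%C *: T) (r * s).
Proof.
by move=> r0 hT x; rewrite bopZE rnormrZ ger0_norm // -mulrA ler_wpM2l.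
Qed.

Lemma bounded_byX T r k : 0 <= r -> bounded_by T r -> bounded_by (T ^+ k) (r ^+ k).
Proof.
move=> r0 hT; elim: k => [|k IH]; first by move=> x; rewrite !expr0 mul1r.
by rewrite !exprS; exact: bounded_byM.
Qed.

Lemma bounded_by_geometric_eq0 T K r : 0 <= r < 1 ->
  (forall k, bounded_by T (K * r ^+ k)) -> T = 0.
Proof.
move=> r01 h; apply: bop_ext => x; apply: rnorm_eq0.
apply: (geometric_bound_eq0 (K := K * rnorm x) r01) => k.
by rewrite ger0_norm ?rnorm_ge0 // mulrAC; exact: h.
Qed.

(** The pointwise limits define an operator. The rate is kept in the
    conclusion, so that identities for the limit follow from
    [bounded_by_geometric_eq0]. *)
Lemma bop_geometric_lim (Y : nat -> bop H) K r : 0 <= r < 1 -> 0 <= K ->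
  (forall k, bounded_by (Y k.+1 - Y k) (K * r ^+ k)) ->
  exists T, forall k, bounded_by (Y k - T) (K / (1 - r) * r ^+ k).
Proof.
move=> r01 K0 dY; have /andP[r0 r1] := r01.
pose C := K / (1 - r); have C0 : 0 <= C by rewrite divr_ge0 // subr_ge0 ltW.
have Ynm x p q : (p <= q)%N -> rnorm (Y p x - Y q x) <= C * r ^+ p * rnorm x.
  move=> /subnKC <-; set d := (q - p)%N.
  (* The geometric sum in closed form, C * (r ^+ p - r ^+ q), makes the
     induction exact. *)
  suff : rnorm (Y p x - Y (p + d)%N x) <= C * (r ^+ p - r ^+ (p + d)) * rnorm x.
    move/le_trans; apply; rewrite ler_wpM2r ?rnorm_ge0 // ler_wpM2l //.
    by rewrite gerBl exprn_ge0.
  elim: d => [|d IH].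
    by rewrite addn0 !subrr mulr0 mul0r /rnorm normr0.
  rewrite addnS -(subrK (Y (p + d)%N x) (Y p x)) -addrA.
  apply: (le_trans (rnormD _ _)); rewrite (rnormB (Y (p + d)%N x)).
  apply: (le_trans (lerD IH (dY _ x))).
  have -> : K = C * (1 - r) by rewrite /C mulfVK // subr_eq0 gt_eqF.
  by rewrite exprS le_eqVlt; apply/orP; left; apply/eqP; ring.
have /choice[f fP] x : exists l, forall k, rnorm (Y k x - l) <= C * r ^+ k * rnorm x.
  apply: (@hilbert_complete _ _ (fun k => Y k x) (fun k => C * r ^+ k * rnorm x)).
    have : C * r ^+ k * rnorm x @[k --> \oo] --> C * 0 * rnorm x.
      by apply: cvgMr_tmp; apply: cvgMl_tmp; apply: cvg_expr; rewrite ger0_norm.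
    by rewrite mulr0 mul0r.
  by move=> p q; exact: Ynm.
have flin c x y : f (c *: x + y) = c *: f x + f y.
  apply/eqP; rewrite -subr_eq0; apply/eqP/rnorm_eq0.
  pose K' := C * rnorm (c *: x + y) + complex.Re `|c| * (C * rnorm x) + C * rnorm y.
  apply: (geometric_bound_eq0 (K := K') r01) => k.
  rewrite ger0_norm ?rnorm_ge0 //.
  have -> : f (c *: x + y) - (c *: f x + f y) =
    - (Y k (c *: x + y) - f (c *: x + y)) + (c *: (Y k x - f x) + (Y k y - f y)).
    rewrite bop_linD bop_linZ opprB scalerBr [X in _ = _ + X]addrACA -opprD.
    by rewrite addrA subrK.
  apply: (le_trans (rnormD _ _)).
  have := rnormD (c *: (Y k x - f x)) (Y k y - f y).
  rewrite rnormN rnormZ.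
  have : complex.Re `|c| * rnorm (Y k x - f x) <=
      complex.Re `|c| * (C * r ^+ k * rnorm x).
    rewrite ler_wpM2l //; first by rewrite normc_def /= sqrtr_ge0.
  have := fP (c *: x + y) k; have := fP y k; rewrite /K'; lra.
have [T hT] : exists T : bop H, forall x, T x = f x.
  have [N N0 hN] := bounded_by_ex (Y 0%N).
  apply: (@bop_of_real _ _ f (N + C)); [by rewrite addr_ge0 // ltW|exact: flin|].
  move=> x; have := fP x 0%N; rewrite expr0 mulr1 mulrDl => h.
  rewrite -[f x](subrK (Y 0%N x)) addrC (le_trans (rnormD _ _)) // lerD //.
  by rewrite rnormB.
by exists T => k x; rewrite bopDE bopNE hT.
Qed.

End GeometricSeries.

(** * Inverse and square root of a positive operator *)

Section PositiveInvertible.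
Context {R : realType} {H : hilbertType R}.
Implicit Types (x y z : H) (c r s : R) (S T U V X Q : bop H).

(** The Neumann series, summed by [bop_geometric_lim]. *)
Lemma neumann_invertible X r : 0 <= r < 1 -> bounded_by X r -> invertible (1 - X).
Proof.
move=> r01 Xr; have /andP[r0 r1] := r01.
pose Y k := \sum_(j < k) X ^+ j.
have YS k : Y k.+1 = Y k + X ^+ k by rewrite /Y big_ord_recr.
have dY k : bounded_by (Y k.+1 - Y k) (1 * r ^+ k).
  by rewrite YS addrAC subrr add0r mul1r; exact: bounded_byX.
have [S YT] := bop_geometric_lim r01 ler01 dY; set C := 1 / _ in YT.
have C0 : 0 <= C by rewrite divr_ge0 // subr_ge0 ltW.
have XY k : (1 - X) * Y k = 1 - X ^+ k.
  elim: k => [|k IH]; first by rewrite /Y big_ord0 mulr0 expr0 subrr.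
  by rewrite YS mulrDr IH mulrBl mul1r -exprS addrA subrK.
have YX k : Y k * (1 - X) = 1 - X ^+ k.
  elim: k => [|k IH]; first by rewrite /Y big_ord0 mul0r expr0 subrr.
  by rewrite YS mulrDl IH mulrBr mulr1 -exprSr addrA subrK.
have X1 : bounded_by (1 - X) (1 + r).
  by apply: bounded_byD; [exact: bounded_by1|exact: bounded_byN].
have r10 : 0 <= 1 + r by rewrite addr_ge0.
exists S; split; apply/eqP; rewrite -subr_eq0; apply/eqP;
  apply: (bounded_by_geometric_eq0 (K := (1 + r) * C + 1) r01) => k;
  have -> : ((1 + r) * C + 1) * r ^+ k = (1 + r) * (C * r ^+ k) + r ^+ k by ring.
- have -> : (1 - X) * S - 1 = - ((1 - X) * (Y k - S) + X ^+ k).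
    by rewrite mulrBr XY addrAC subrK opprB.
  by apply: bounded_byN; apply: bounded_byD; [exact: bounded_byM|exact: bounded_byX].
- have -> : S * (1 - X) - 1 = - ((Y k - S) * (1 - X) + X ^+ k).
    by rewrite mulrBl YX addrAC subrK opprB.
  apply: bounded_byN; apply: bounded_byD; [|exact: bounded_byX].
  by rewrite mulrC; apply: bounded_byM => //; rewrite mulr_ge0 // exprn_ge0.
Qed.

(** After scaling, a positive operator bounded below differs from the identity
    by a self-adjoint strict contraction: from c <= Q <= M follows
    0 <= 1 - Q / M <= 1 - c / M. *)
Lemma pos_coercive_scaled Q c : posop Q -> 0 < c ->
  (forall x, c * rdot x x <= rdot (Q x) x) ->
  exists M r X, [/\ 0 < M, 0 <= r < 1, selfadjoint X, bounded_by X r &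
                    Q = M%:C%C *: (1 - X)].
Proof.
move=> Q0 c0 Qc; have [N N0 QN] := bounded_by_ex Q.
(* Adding c to the norm bound ensures c <= M even on the zero space. *)
pose M := N + c; have M0 : 0 < M by rewrite addr_gt0.
pose X : bop H := 1 - (M^-1)%:C%C *: Q.
have XE x : rdot (X x) x = rdot x x - M^-1 * rdot (Q x) x.
  by rewrite /X bopDE bopNE bopZE rdotBl rdotrZl.
have QM x : rdot (Q x) x <= M * rdot x x.
  have := bounded_by_form x QN; rewrite ler_norml => /andP[_]; rewrite /M mulrDl.
  by have := mulr_ge0 (ltW c0) (rdot_ge0 x); lra.
have X0 : posop X.
  apply/posopP; split=> [|x].
    apply: selfadjointD; first exact: selfadjoint1.
    exact/selfadjointN/selfadjointZ/posop_selfadjoint.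
  by rewrite XE subr_ge0 ler_pdivrMl.
have r01 : 0 <= 1 - c / M < 1.
  rewrite subr_ge0 ler_pdivrMr // mul1r lerDr (ltW N0) /=.
  by rewrite ltrBlDr ltrDl divr_gt0.
exists M, (1 - c / M), X; split => //; first exact: posop_selfadjoint.
  apply: posop_bounded_by => //; first by case/andP: r01.
  move=> x; rewrite XE mulrBl mul1r lerB // (mulrC c) -mulrA ler_pM2l //.
  by rewrite invr_gt0.
rewrite /X opprB addrC subrK scalerA -rmorphM mulfV ?gt_eqF //.
by rewrite scale1r.
Qed.

Lemma pos_coercive_invertible Q c : posop Q -> 0 < c ->
  (forall x, c * rdot x x <= rdot (Q x) x) -> invertible Q.
Proof.
move=> Q0 c0 Qc; have [M [r [X [M0 r01 _ Xr ->]]]] := pos_coercive_scaled Q0 c0 Qc.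
have [S [XS SX]] := neumann_invertible r01 Xr.
have MM : M%:C%C * (M^-1)%:C%C = 1 by rewrite -rmorphM mulfV ?gt_eqF.
exists ((M^-1)%:C%C *: S).
by rewrite scaleMl !scaleMr scaleMl !scalerA MM XS SX !scale1r.
Qed.

(** Cauchy-Schwarz for the form of Q at Q^-1 x and x reads
    |x|^4 <= <x, Q^-1 x> <Q x, x>, and the first factor is at most
    |Q^-1| |x|^2. *)
Lemma pos_invertible_coercive Q : posop Q -> invertible Q ->
  exists2 c, 0 < c & forall x, c * rdot x x <= rdot (Q x) x.
Proof.
move=> Q0 [S [QS _]]; have [N N0 SN] := bounded_by_ex S.
exists N^-1 => [|x]; first by rewrite invr_gt0.
rewrite ler_pdivrMl //.
have QSx : Q (S x) = x by rewrite -[Q (S x)]/((Q * S) x) QS.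
have := posop_CauchySchwarz (S x) x Q0; rewrite QSx.
have := bounded_by_form x SN; rewrite rdotC ler_norml => /andP[_ h1] h2.
have h3 := posop_ge0 x Q0.
have := rdot_ge0 x; rewrite le_eqVlt => /predU1P[<-|x0].
  by rewrite mulr_ge0 // ltW.
rewrite -(ler_pM2l x0) -expr2 (le_trans h2) // mulrCA mulrA ler_wpM2r //.
Qed.

(** The equation (1 - T)^2 = 1 - X is the fixed point equation
    T = (X + T^2) / 2. On operators of norm at most r the right side is a
    contraction of ratio r, so the iterates from 0 converge geometrically; they
    are self-adjoint, hence so is T. *)
Lemma sqrt_one_minus X r : 0 <= r < 1 -> selfadjoint X -> bounded_by X r ->
  exists2 T, selfadjoint T & (1 - T) * (1 - T) = 1 - X.
Proof.
move=> r01 Xs Xr; have /andP[r0 r1] := r01.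
pose h : R[i] := (2^-1)%:C%C.
have hh : h + h = 1 by rewrite -rmorphD /=; congr (_%:C%C); field.
pose Y k := iter k (fun Z => h *: (X + Z * Z)) 0.
have h0 : 0 <= 2^-1 :> R by rewrite invr_ge0.
have Yr k : bounded_by (Y k) r.
  elim: k => [|k IH].
    by move=> x; rewrite bop0E /rnorm normr0 mulr_ge0 ?rnorm_ge0.
  apply: (@bounded_by_le _ _ _ (2^-1 * (r + r * r))); first by nra.
  by apply: bounded_byZ => //; apply: bounded_byD => //; exact: bounded_byM.
have Ys k : selfadjoint (Y k).
  elim: k => [|k IH]; first by move=> x y; rewrite !bop0E rdot0l rdot0r.
  by apply: selfadjointZ; apply: selfadjointD => // x y; rewrite !bopME !IH.
have dE S T : S * S - T * T = S * (S - T) + (S - T) * T.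
  by rewrite mulrBr mulrBl addrA subrK.
have dY k : bounded_by (Y k.+1 - Y k) (1 * r ^+ k).
  elim: k => [|k IH].
    rewrite subr0 /= mulr0 addr0 mulr1.
    apply: (@bounded_by_le _ _ _ (2^-1 * r)); first lra.
    exact: bounded_byZ.
  have -> : Y k.+2 - Y k.+1 = h *: (Y k.+1 * (Y k.+1 - Y k) + (Y k.+1 - Y k) * Y k).
    by rewrite -dE -scalerBr opprD addrACA subrr add0r.
  have -> : 1 * r ^+ k.+1 = 2^-1 * (r * (1 * r ^+ k) + (1 * r ^+ k) * r).
    by rewrite exprS; field.
  apply: bounded_byZ => //; apply: bounded_byD; apply: bounded_byM => //.
  by rewrite mul1r exprn_ge0.
have [T YT] := bop_geometric_lim r01 ler01 dY; set C := 1 / _ in YT.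
have C0 : 0 <= C by rewrite divr_ge0 // subr_ge0 ltW.
have [N N0 TN] := bounded_by_ex T.
have Ts : selfadjoint T.
  move=> x y; apply/eqP; rewrite -subr_eq0; apply/eqP.
  apply: (geometric_bound_eq0 (K := 2 * C * rnorm x * rnorm y) r01) => k.
  have h1 := rdot_CauchySchwarz ((Y k - T) x) y.
  have h2 := rdot_CauchySchwarz x ((Y k - T) y).
  have := ler_wpM2r (rnorm_ge0 y) (YT k x); have := ler_wpM2l (rnorm_ge0 x) (YT k y).
  move: h1 h2; rewrite !bopDE !bopNE rdotBl rdotBr (Ys k x y).
  rewrite !ler_norml; lra.
exists T => //.
have TE : T = h *: (X + T * T).
  apply/eqP; rewrite -subr_eq0; apply/eqP.
  apply: (bounded_by_geometric_eq0 (K := C * r + 2^-1 * (r * C + C * N)) r01) => k.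
  have -> : T - h *: (X + T * T) =
      - (Y k.+1 - T) + h *: (Y k * (Y k - T) + (Y k - T) * T).
    rewrite -dE opprB -[RHS]addrA; congr (T + _) => /=.
    by rewrite -!scalerN -scalerDr; congr (h *: _); rewrite !opprD addrA subrK.
  have -> : (C * r + 2^-1 * (r * C + C * N)) * r ^+ k =
      C * r ^+ k.+1 + 2^-1 * (r * (C * r ^+ k) + (C * r ^+ k) * N).
    by rewrite exprS; field.
  apply: bounded_byD; first exact: bounded_byN.
  apply: bounded_byZ => //; apply: bounded_byD; apply: bounded_byM => //.
  by rewrite mulr_ge0 // exprn_ge0.
have T2 : T + T = X + T * T by rewrite {1 2}TE -scalerDl hh scale1r.
rewrite mulrBr mulr1 mulrBl mul1r opprD opprK addrA -(addrA 1) -opprD T2.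
by rewrite opprD addrA subrK.
Qed.

(** Up to the scaling by M, the square root comes from [sqrt_one_minus]; a
    self-adjoint U satisfies U * adj U = U * U. *)
Lemma pos_invertible_factor Q : posop Q -> invertible Q ->
  exists U V : bop H, [/\ U * V = 1, V * U = 1 & U * adj U = Q].
Proof.
move=> Q0 Qi; have [c c0 Qc] := pos_invertible_coercive Q0 Qi.
have [M [r [X [M0 r01 Xs Xr QE]]]] := pos_coercive_scaled Q0 c0 Qc.
have [T Ts T2] := sqrt_one_minus r01 Xs Xr.
pose U : bop H := (Num.sqrt M)%:C%C *: (1 - T).
have Us : selfadjoint U.
  apply/selfadjointZ/selfadjointD; first exact: selfadjoint1.
  exact: selfadjointN.
have UU : U * U = Q.
  rewrite /U scaleMl scaleMr scalerA -rmorphM -expr2 sqr_sqrtr ?ltW //.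
  by rewrite T2 -QE.
have [S [QS SQ]] := Qi.
have UV : U * (U * S) = 1 by rewrite mulrA UU.
have VU : (S * U) * U = 1 by rewrite -mulrA UU.
have VV : U * S = S * U by rewrite -[LHS]mul1r -VU -mulrA UV mulr1.
exists U, (U * S); split=> //; first by rewrite VV.
by rewrite (adj_uniq Us).
Qed.

End PositiveInvertible.

(** * Power bounded maps *)

Section PowerBounded.
Context {R : realType} {H : hilbertType R}.
Implicit Types (x y z : H) (S T E F P Q : bop H).

Lemma opnorm_leP T (M : R) : 0 <= M -> (opnorm T <= M%:E)%E <-> bounded_by T M.
Proof.
move=> M0; split=> [TM x|TM]; last first.
  apply: ub_ereal_sup => _ [x /= x1 <-]; rewrite lee_fin -/(rnorm (T x)).
  rewrite (le_trans (TM x)) // ler_piMr //.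
  by move: x1; rewrite rnormE -[1]/(1%:C%C) lecR.
have [x0|x0] := eqVneq (rnorm x) 0.
  by rewrite (rnorm_eq0 x0) bop_lin0 /rnorm normr0 mulr0.
have xp : 0 < rnorm x by rewrite lt_def x0 rnorm_ge0.
rewrite -ler_pdivrMr // mulrC.
have -> : (rnorm x)^-1 * rnorm (T x) = rnorm (T ((rnorm x)^-1%:C%C *: x)).
  by rewrite bop_linZ rnormrZ ger0_norm // invr_ge0 ltW.
rewrite -lee_fin (le_trans _ TM) //; apply: ereal_sup_ubound.
exists ((rnorm x)^-1%:C%C *: x) => //=.
rewrite rnormE rnormrZ ger0_norm ?invr_ge0 ?(ltW xp) // mulVf //.
Qed.

Lemma iter_linear (phi : bop H -> bop H) k : linear phi -> linear (iter k phi).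
Proof.
by move=> pl c x y; elim: k => [//|k IH] /=; rewrite IH pl.
Qed.

Lemma power_boundedP (phi : bop H -> bop H) : linear phi ->
  power_bounded phi <-> exists2 M : R, 0 < M &
    forall k, (0 < k)%N -> forall T r, 0 <= r -> bounded_by T r ->
    bounded_by (iter k phi T) (M * r).
Proof.
move=> pl; split=> -[M M0 hM]; exists M => // k k0; last first.
  apply: ub_ereal_sup => _ [T /= /opnorm_leP T1 <-].
  by apply/opnorm_leP; [exact: ltW|rewrite -[M]mulr1; apply: hM => //; exact: T1].
have h1 T : bounded_by T 1 -> bounded_by (iter k phi T) M.
  move=> T1; apply/opnorm_leP; first exact: ltW.
  rewrite (le_trans _ (hM k k0)) //; apply: ereal_sup_ubound.
  by exists T => //=; apply/opnorm_leP.
have h2 T r : 0 < r -> bounded_by T r -> bounded_by (iter k phi T) (M * r).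
  move=> r0 Tr.
  have -> : T = r%:C%C *: (r^-1%:C%C *: T).
    by rewrite scalerA -rmorphM mulfV ?gt_eqF // scale1r.
  rewrite (lin_mapZ (iter_linear k pl)) mulrC; apply: bounded_byZ; first exact: ltW.
  apply: h1; rewrite -(mulVf (lt0r_neq0 r0)); apply: bounded_byZ => //.
  by rewrite invr_ge0 ltW.
move=> T r; rewrite le_eqVlt => /predU1P[<-|]; last exact: h2.
move=> T0; have -> : T = 0.
  apply: bop_ext => x; apply: rnorm_eq0; apply/eqP.
  by rewrite eq_le rnorm_ge0 andbT (le_trans (T0 x)) // mul0r.
rewrite (lin_map0 (iter_linear k pl)) => x.
by rewrite mulr0 mul0r /rnorm normr0.
Qed.

(** A power bounded map has no Jordan block at 1: if F = E - phi E is fixed,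
    then E - phi^k E = k F, and the left side is bounded in k. *)
Lemma fixed_coboundary_eq0 (phi : bop H -> bop H) E : linear phi ->
  power_bounded phi -> phi (E - phi E) = E - phi E -> E - phi E = 0.
Proof.
move=> pl /(power_boundedP pl)[M M0 hM] F1; set F := E - phi E in F1 *.
have [N N0 EN] := bounded_by_ex E.
have tele k : E - iter k phi E = k%:R%:C%C *: F.
  elim: k => [|k IH]; first by rewrite subrr scale0r.
  have Fk : iter k phi F = F by elim: (k) => [//|j /= ->].
  rewrite -addn1 natrD rmorphD scalerDl -IH scale1r -[X in _ = _ + X]Fk /F.
  by rewrite (lin_mapB (iter_linear k pl)) -iterSr addrA subrK addn1.
apply: bop_ext => x; apply: rnorm_eq0.
apply: (harmonic_bound_eq0 (K := (N + M * N) * rnorm x)) => k.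
rewrite ger0_norm ?rnorm_ge0 // ler_pdivlMr ?ltr0n // mulrC.
have -> : k.+1%:R * rnorm (F x) = rnorm ((E - iter k.+1 phi E) x).
  by rewrite tele bopZE rnormrZ ger0_norm // ler0n.
by apply: bounded_byD => //; apply: bounded_byN; apply: hM => //; exact: ltW.
Qed.

Lemma iter_id_minus_eq0 (phi : bop H -> bop H) m Q : linear phi ->
  power_bounded phi -> (0 < m)%N -> iter m (id_minus phi) Q = 0 -> phi Q = Q.
Proof.
move=> pl pb; case: m => // m _; elim: m => [|m IH].
  by move=> /= /eqP; rewrite /id_minus subr_eq0 => /eqP.
move=> e; apply: IH; move: e; rewrite !iterS {1 2}/id_minus => /eqP.
rewrite subr_eq0 => /eqP e; exact: fixed_coboundary_eq0.
Qed.

Lemma fixed_iter_id_minus (phi : bop H -> bop H) m Q : linear phi ->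
  (0 < m)%N -> phi Q = Q -> iter m (id_minus phi) Q = 0.
Proof.
move=> pl; case: m => // m _ pQ; elim: m => [|m IH].
  by rewrite /= /id_minus pQ subrr.
by rewrite iterS IH /id_minus (lin_map0 pl) subrr.
Qed.

End PowerBounded.

Section PositiveMaps.
Context {R : realType} {H : hilbertType R}.
Implicit Types (x y z : H) (S T E F P Q : bop H).
Context (phi : bop H -> bop H).
Context (pl : linear phi) (pp : forall P, posop P -> posop (phi P)).

Lemma iter_pos k P : posop P -> posop (iter k phi P).
Proof. by move=> P0; elim: k => //= k; exact: pp. Qed.

Lemma iter_le k S T : selfadjoint S -> selfadjoint T ->
  (forall x, rdot (S x) x <= rdot (T x) x) ->
  forall x, rdot (iter k phi S x) x <= rdot (iter k phi T x) x.
Proof.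
move=> Ss Ts ST x; rewrite -subr_ge0 -rdotBl.
have : posop (T - S) by apply/leopP.
move=> /(iter_pos k); rewrite (lin_mapB (iter_linear k pl)).
by move=> /posop_ge0; apply.
Qed.

(** The bound at 1 controls the whole space: 0 <= P <= 2 M gives
    0 <= phi^k P <= 2 M phi^k 1, and T is made of two such P and two multiples of 1. *)
Lemma iter_bounded_by k d M T : 0 <= d -> 0 <= M ->
  (forall x, rdot (iter k phi 1 x) x <= d * rdot x x) -> bounded_by T M ->
  bounded_by (iter k phi T) (6 * d * M).
Proof.
move=> d0 M0 k1 TM.
have [P [Q [P0 Q0 PM QM ->]]] := posop_decomposition M0 TM.
have kl := iter_linear k pl.
have posb S : posop S -> (forall x, rdot (S x) x <= 2 * M * rdot x x) ->
    bounded_by (iter k phi S) (2 * M * d).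
  move=> S0 SM; apply: posop_bounded_by; first by rewrite !mulr_ge0.
    exact: iter_pos.
  move=> x.
  apply: (@le_trans _ _ (rdot (iter k phi ((2 * M)%:C%C *: (1 : bop H)) x) x)).
    apply: iter_le; [exact: posop_selfadjoint|exact/selfadjointZ/selfadjoint1|].
    by move=> y; rewrite bopZE rdotrZl.
  by rewrite (lin_mapZ kl) bopZE rdotrZl -mulrA ler_wpM2l // mulr_ge0.
have oneb : bounded_by (M%:C%C *: iter k phi 1) (M * d).
  by apply: bounded_byZ => //; apply: posop_bounded_by => //; exact/iter_pos/posop1.
have subb S : posop S -> (forall x, rdot (S x) x <= 2 * M * rdot x x) ->
    bounded_by (iter k phi (S - M%:C%C *: (1 : bop H))) (3 * d * M).
  move=> S0 SM; rewrite (lin_mapB kl) (lin_mapZ kl).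
  have -> : 3 * d * M = 2 * M * d + M * d by ring.
  by apply: bounded_byD; [exact: posb|exact: bounded_byN].
rewrite (lin_mapD kl) (lin_mapZ kl).
have -> : 6 * d * M = 3 * d * M + 3 * d * M by ring.
by apply: bounded_byD; [exact: subb|move=> x; rewrite bopZE rnormi; exact: subb].
Qed.

Lemma pos_power_bounded d : 0 < d ->
  (forall k, (0 < k)%N -> forall x, rdot (iter k phi 1 x) x <= d * rdot x x) ->
  power_bounded phi.
Proof.
move=> d0 hd; apply/power_boundedP => //; exists (6 * d); first by rewrite mulr_gt0.
by move=> k k0 T r r0 Tr; apply: iter_bounded_by => //; [exact: ltW|exact: hd].
Qed.

End PositiveMaps.

Section UltraLimits.
Context {R : realType}.

(** By compactness of [a, b] the values cluster at some p, and an ultrafilter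
    converges to its cluster points. *)
Lemma ultra_bounded_cvg (I : Type) (U : set_system I) (f : I -> R) (a b : R) :
  UltraFilter U -> (forall i, a <= f i <= b) -> cvg (f @ U).
Proof.
move=> UU fab.
have UP : ProperFilter U by exact: ultra_proper.
have [p [_ clp]] : `[a, b]%classic `&` cluster (f @ U) !=set0.
  apply: segment_compact; apply: (@filterS _ U _ setT); last exact: filterT.
  by move=> i _ /=; rewrite in_itv /= fab.
apply: (cvgP p); apply/cvgrPdist_lt => e e0.
have [//|Uc] := in_ultra_setVsetC [set i | `|p - f i| < e] UU.
have Uf : (f @ U) (~` ball p e) by move: Uc; rewrite -ball_normE.
by have [y [ny]] := clp _ _ Uf (nbhsx_ballx p e e0).
Qed.
End UltraLimits.

(** * Fixed points by averaging, and the equivalence *)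

Section CesaroMeans.
Context {R : realType} {n : nat} {H : hilbertType R}.
Context (a : seq 'I_n -> R) (X : 'I_n -> bop H).
Context (a0 : forall w, 0 <= a w) (hX : Phi_summable a X).
Local Notation phi := (Phi a X).

(** Q is the weak limit of the Cesaro means of phi^k 1 along a free
    ultrafilter. Telescoping shows that phi moves the N-th mean by O(1/N), and
    normality passes this to the limit. *)
Lemma fixed_point_between c d : 0 <= c -> 0 <= d ->
  (forall k, (0 < k)%N -> forall x,
    c * rdot x x <= rdot (iter k phi 1 x) x <= d * rdot x x) ->
  exists Q, [/\ posop Q, forall x, c * rdot x x <= rdot (Q x) x & phi Q = Q].
Proof.
move=> c0 d0 hcd; have pl : linear phi by exact: Phi_lin.
have pp P : posop P -> posop (phi P) by exact: Phi_pos.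
pose s N : bop H := \sum_(k < N) iter k.+1 phi 1.
pose u N : bop H := (N.+1%:R^-1)%:C%C *: s N.+1.
have s0 N : posop (s N).
  apply: (big_ind (fun T : bop H => posop T)); [exact: posop0|exact: posopD|].
  by move=> k _; apply: iter_pos => //; exact: posop1.
have i0 N : 0 <= N.+1%:R^-1 :> R by rewrite invr_ge0.
have u0 N : posop (u N) by exact: posopZ.
have sE N x : c * rdot x x * N%:R <= rdot (s N x) x <= d * rdot x x * N%:R.
  elim: N => [|N IH]; first by rewrite /s big_ord0 bop0E rdot0l !mulr0 lexx.
  rewrite /s big_ord_recr -/(s N) bopDE rdotDl -natr1 !mulrDr !mulr1.
  move/andP: IH => [IH1 IH2]; have /andP[h1 h2] := hcd N.+1 isT x.
  by rewrite !lerD.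
have ub N x : c * rdot x x <= rdot (u N x) x <= d * rdot x x.
  have N0 : 0 < N.+1%:R :> R by rewrite ltr0n.
  by rewrite bopZE rdotrZl (mulrC N.+1%:R^-1) ler_pdivlMr // ler_pdivrMr.
(* The means start at phi 1, since the bounds concern k > 0 only. *)
have tele N : phi (s N) - s N = iter N.+1 phi 1 - phi 1.
  elim: N => [|N IH]; first by rewrite /s big_ord0 (lin_map0 pl) !subrr.
  rewrite /s big_ord_recr /= -/(s N) (lin_mapD pl) opprD addrACA IH.
  by rewrite addrC addrA subrK.
have [U [UU sU]] := ultraFilterLemma (eventually_filter : ProperFilter \oo).
have UP : ProperFilter U by exact: ultra_proper.
have [Q Q0 uQ] : exists2 Q, posop Q & wot_cvg U u Q.
  apply: (wot_cvg_posop (M := d)) => //.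
    by move=> N x; have /andP[] := ub N x.
  by move=> x; exact: (ultra_bounded_cvg _ (fun N => ub N x)).
have uQx x : rdot (u N x) x @[N --> U] --> rdot (Q x) x.
  by move/wot_cvgP: uQ; exact.
exists Q; split=> // [x|].
  apply: (cvgr_to_ge (uQx x)); apply: nearW => N.
  by have /andP[] := ub N x.
apply: selfadjoint_ext; [exact/posop_selfadjoint/pp|exact: posop_selfadjoint|move=> x].
have Qd y : rdot (Q y) y <= d * rdot y y.
  apply: (cvgr_to_le (uQx y)); apply: nearW => N.
  by have /andP[] := ub N y.
have pQ : rdot (phi (u N) x) x @[N --> U] --> rdot (phi Q x) x.
  apply: (Phi_normal a0 hX UP d0) => // N y.
  by have /andP[] := ub N y.
have diff N : `|rdot (phi (u N) x) x - rdot (u N x) x| <=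
    d * rdot x x * N.+1%:R^-1.
  rewrite -rdotBl -[phi _ x - _]/((phi (u N) - u N) x) /u (lin_mapZ pl).
  rewrite -scalerBr tele bopZE rdotrZl normrM (ger0_norm (i0 _)) mulrC.
  rewrite ler_wpM2r // bopDE bopNE rdotBl.
  have /andP[h1 h2] := hcd N.+2 isT x; have /andP[h3 h4] := hcd 1%N isT x.
  have := mulr_ge0 c0 (rdot_ge0 x).
  by rewrite ler_norml; move: h1 h2 h3 h4 => /=; lra.
have lim0 : rdot (phi (u N) x) x - rdot (u N x) x @[N --> U] --> (0 : R).
  apply/cvgr0Pnorm_le => e e0; apply: sU.
  have : d * rdot x x * N.+1%:R^-1 @[N --> \oo] --> d * rdot x x * 0.
    by apply: cvgMl_tmp; exact: cvg_harmonic.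
  rewrite mulr0 => /cvgr0Pnorm_le /(_ _ e0); apply: filterS => N.
  by apply: le_trans; rewrite (le_trans (diff N)) // ler_norm.
apply/eqP; rewrite -subr_eq0; apply/eqP.
exact: (cvg_eq_unique _ (fun=> erefl) (cvgB pQ (uQx x)) lim0).
Qed.

End CesaroMeans.

Section InverseAdjoint.
Context {R : realType} {H : hilbertType R}.
Implicit Types (U V : bop H).

Lemma adj_sqr_le U N x : 0 <= N -> bounded_by U N ->
  rdot (adj U x) (adj U x) <= N ^+ 2 * rdot x x.
Proof.
move=> N0 UN; rewrite -!rnorm_sqr -exprMn ler_pXn2r ?nnegrE ?rnorm_ge0 //.
  exact: adj_bounded_by.
by rewrite mulr_ge0 // rnorm_ge0.
Qed.

(** The adjoint of an invertible operator is bounded below: x is the image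
    under the adjoint of V of the image of x under the adjoint of U. *)
Lemma adj_sqr_ge U V N x : U * V = 1 -> 0 <= N -> bounded_by V N ->
  rdot x x <= N ^+ 2 * rdot (adj U x) (adj U x).
Proof.
move=> UV N0 VN; have {1 2}-> : x = adj V (adj U x).
  by rewrite -[RHS]/((adj V * adj U) x) -adjM UV adj1.
exact: adj_sqr_le.
Qed.

End InverseAdjoint.

Theorem theorem3p5 (R : realType) (H : hilbertType R) (n m : nat)
    (hn : (0 < n)%N) (hm : (0 < m)%N)
    (a : seq 'I_n -> R) (ha : positive_regular a)
    (P : set (ncpoly R n)) (A : 'I_n -> bop H)
    (hA : Phi_summable a A)
    (hP : forall p, P p -> ncpoly_eval A p = 0) :
  [<-> (* (i) *)
       exists T : 'I_n -> bop H,
         [/\ variety_V a m P T,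
             iter m (id_minus (Phi a T)) 1 = 0 &
             exists Y Yinv : bop H,
               [/\ Y * Yinv = 1, Yinv * Y = 1 &
                   forall i, A i = Yinv * T i * Y]];
       (* (ii) *)
       exists c d : R, [/\ 0 < c, c <= d &
         forall k, (0 < k)%N ->
           leop (c%:C%C *: (1 : bop H)) (iter k (Phi a A) 1) /\
           leop (iter k (Phi a A) 1) (d%:C%C *: (1 : bop H))];
       (* (iii) *)
       power_bounded (Phi a A) /\
       exists Q : bop H, [/\ invertible Q, posop Q &
         iter m (id_minus (Phi a A)) Q = 0]].
Proof.
have a0 : forall w, 0 <= a w by case: ha.
have Al : linear (Phi a A) by exact: Phi_lin.
have Ap S : posop S -> posop (Phi a A S) by exact: Phi_pos.
have A1s k : selfadjoint (iter k (Phi a A) 1).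
  by apply/posop_selfadjoint/iter_pos => //; exact: posop1.
have r1s r : selfadjoint (r%:C%C *: (1 : bop H)).
  exact/selfadjointZ/selfadjoint1.
have leopE k c d : leop (c%:C%C *: (1 : bop H)) (iter k (Phi a A) 1) /\
    leop (iter k (Phi a A) 1) (d%:C%C *: (1 : bop H)) <->
    forall x, c * rdot x x <= rdot (iter k (Phi a A) 1 x) x <= d * rdot x x.
  have E r x : rdot ((r%:C%C *: (1 : bop H)) x) x = r * rdot x x.
    by rewrite bopZE rdotrZl.
  split=> [[]|h].
    move=> /(leopP (r1s c) (A1s k)) h1 /(leopP (A1s k) (r1s d)) h2 x.
    by rewrite -(E c) -(E d) h1 h2.
  split; [apply/(leopP (r1s c) (A1s k))|apply/(leopP (A1s k) (r1s d))];
    by move=> x; rewrite E; have /andP[] := h x.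
tfae.
- move=> [T [[[hT Tpos] _] Tm [Y [Yinv [YY' Y'Y AE]]]]].
  have Tl : linear (Phi a T) by exact: Phi_lin.
  have Tp S : posop S -> posop (Phi a T S) by exact: Phi_pos.
  have T1 x : rdot (Phi a T 1 x) x <= rdot x x.
    have := Tpos 1%N; rewrite /= hm => /(_ isT) h; have := posop_ge0 x h.
    by rewrite /id_minus bopDE bopNE rdotBl subr_ge0.
  have Tk k x : rdot (iter k (Phi a T) 1 x) x <= 1 * rdot x x.
    rewrite mul1r; elim: k => [//|k IH]; rewrite iterSr (le_trans _ IH) //.
    apply: iter_le => //; exact/posop_selfadjoint/Tp/posop1.
  have Tpb : power_bounded (Phi a T).
    by apply: (pos_power_bounded Tl Tp ltr01) => k _; exact: Tk.
  have Tfix := iter_id_minus_eq0 Tl Tpb hm Tm.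
  have T1k k : iter k (Phi a T) 1 = 1 by elim: k => // k /= ->.
  have [N' N'0 YN'] := bounded_by_ex Y; have [M' M'0 YM'] := bounded_by_ex Yinv.
  (* Bounds at least 1 make the resulting constants satisfy c <= d, also on
     the zero space. *)
  pose N := N' + 1; pose M := M' + 1.
  have YN : bounded_by Y N by apply: bounded_by_le YN'; rewrite lerDl.
  have YM : bounded_by Yinv M by apply: bounded_by_le YM'; rewrite lerDl.
  have N1 : 1 <= N by rewrite lerDr ltW.
  have M1 : 1 <= M by rewrite lerDr ltW.
  have N0 : 0 < N by rewrite (lt_le_trans ltr01).
  have M0 : 0 < M by rewrite (lt_le_trans ltr01).
  have NM : 1 <= (N * M) ^+ 2 by rewrite exprn_ege1 // mulr_ege1.
  have NM0 : 0 < (N * M) ^+ 2 by rewrite (lt_le_trans ltr01).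
  exists ((N * M) ^+ 2)^-1, ((N * M) ^+ 2); split.
  + by rewrite invr_gt0.
  + by rewrite (le_trans _ NM) // invf_le1.
  move=> k _; apply/leopE => x.
  have -> : iter k (Phi a A) 1 =
      Yinv * iter k (Phi a T) (Y * 1 * adj Y) * adj Yinv.
    exact: (iter_Phi_sim a0 Y'Y YY' AE hT).
  rewrite mulr1 !bopME adjP; set y := adj Yinv x.
  have YYs : selfadjoint (Y * adj Y) by move=> u v; rewrite !bopME adjP adjPr.
  have E z : rdot ((Y * adj Y) z) z = rdot (adj Y z) (adj Y z).
    by rewrite bopME adjP.
  have low : (M ^+ 2)^-1 * rdot y y <=
      rdot (iter k (Phi a T) (Y * adj Y) y) y.
    have -> : (M ^+ 2)^-1 * rdot y y =
        rdot (iter k (Phi a T) ((M ^+ 2)^-1%:C%C *: (1 : bop H)) y) y.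
      by rewrite (lin_mapZ (iter_linear k Tl)) T1k bopZE rdotrZl.
    apply: iter_le => // z.
    rewrite E bopZE rdotrZl ler_pdivrMl ?exprn_gt0 //.
    by apply: adj_sqr_ge YY' _ YM; exact: ltW.
  have upp : rdot (iter k (Phi a T) (Y * adj Y) y) y <= N ^+ 2 * rdot y y.
    have -> : N ^+ 2 * rdot y y =
        rdot (iter k (Phi a T) ((N ^+ 2)%:C%C *: (1 : bop H)) y) y.
      by rewrite (lin_mapZ (iter_linear k Tl)) T1k bopZE rdotrZl.
    apply: iter_le => // z.
    by rewrite E bopZE rdotrZl; apply: adj_sqr_le YN; exact: ltW.
  apply/andP; split.
    apply: le_trans low; rewrite exprMn invfM (mulrC (N ^+ 2)^-1) -mulrA.
    rewrite ler_pM2l ?invr_gt0 ?exprn_gt0 // ler_pdivrMl ?exprn_gt0 //.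
    by apply: adj_sqr_ge Y'Y _ YN; exact: ltW.
  apply: (le_trans upp); rewrite exprMn -(mulrA (N ^+ 2) (M ^+ 2)).
  rewrite ler_pM2l ?exprn_gt0 //.
  by apply: adj_sqr_le YM; exact: ltW.
- move=> [c [d [c0 cd hcd]]].
  have d0 : 0 < d by exact: lt_le_trans cd.
  have hcd' k : (0 < k)%N -> forall x,
      c * rdot x x <= rdot (iter k (Phi a A) 1 x) x <= d * rdot x x.
    by move=> /hcd /leopE.
  split.
    by apply: (pos_power_bounded Al Ap d0) => k k0 x; have /andP[] := hcd' k k0 x.
  have [Q [Q0 Qc QE]] := fixed_point_between a0 hA (ltW c0) (ltW d0) hcd'.
  exists Q; split=> //; first exact: pos_coercive_invertible Qc.
  exact: fixed_iter_id_minus.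
- move=> [pb [Q [Qi Q0 Qm]]].
  have QE := iter_id_minus_eq0 Al pb hm Qm.
  have [U [V [UV VU UQ]]] := pos_invertible_factor Q0 Qi.
  pose T i := V * A i * U.
  have TE i : T i = V * A i * U by [].
  have T1 : Phi a T 1 = 1.
    rewrite (Phi_sim a0 VU UV TE hA) mulr1 UQ QE -UQ.
    by rewrite !mulrA VU mul1r -adjM VU adj1.
  have hT := Phi_summable_sim a0 VU UV TE hA.
  have Tl : linear (Phi a T) by exact: Phi_lin.
  exists T; split.
  + split=> [|p /hP pA]; last by rewrite (ncpoly_eval_sim VU UV TE) pA mulr0 mul0r.
    split=> // s /andP[s0 _]; rewrite fixed_iter_id_minus //; exact: posop0.
  + exact: fixed_iter_id_minus.
  + exists V, U; split=> // i.
    by rewrite /T !mulrA UV mul1r -mulrA UV mulr1.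
Qed.
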